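(* For any real $\lambda>0$ and any $z\in\mathbb{C}$ with $\Im(z)>0$, $$\int \frac{1}{(z-x)^{\lambda}}\,(\kappa_{\lambda}\star\kappa_{\lambda+1})(dx) = \frac{2^{\lambda}}{\left[z+\sqrt{z(z-1)}\right]^{\lambda}}.$$
   Context: For $\lambda>0$, $\kappa_\lambda$ is the probability measure on $[0,1]$ with density $\frac{\Gamma(\lambda)}{[\Gamma(\lambda/2)]^2}[x(1-x)]^{(\lambda/2)-1}\mathbf{1}_{[0,1]}(x)$. $\kappa_\lambda\star\mu$ denotes the multiplicative convolution, i.e. the law of the product of two independent random variables with laws $\kappa_\lambda$ and $\mu$: $\int f(x)\,(\kappa_\lambda\star\mu)(dx) = \iint f(uv)\,\kappa_\lambda(du)\,\mu(dv)$ for bounded measurable $f$. Powers with exponent $\lambda$ are principal powers, and $\sqrt{z(z-1)}$ means $\sqrt{z}\sqrt{z-1}$ with principal square roots (the branch that behaves like $z$ at infinity). *)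

(* Defs.v *)
From HB Require Import structures.
From mathcomp Require Import all_boot all_order all_algebra.
From mathcomp Require Import complex.
From mathcomp Require Import all_classical all_reals all_analysis.
From mathcomp Require Import measurable_realfun.

Set Implicit Arguments.
Unset Strict Implicit.
Unset Printing Implicit Defensive.

Import Order.TTheory GRing.Theory Num.Theory.
Import numFieldNormedType.Exports.

Local Open Scope classical_set_scope.
Local Open Scope ring_scope.
Local Open Scope complex_scope.

Section complex_functions.
Context {R : realType}.
Implicit Types z : R[i].

Definition cmod z : R := ComplexField.Normc.normc z.

(* Principal argument, with values in ]-pi, pi]; the value at 0 is irrelevant. *)
Definition carg z : R :=
  if 0 <= complex.Im z then acos (complex.Re z / cmod z)
  else - acos (complex.Re z / cmod z).

Definition clog z : R[i] := ln (cmod z) +i* carg z.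

Definition cexp z : R[i] :=
  (expR (complex.Re z))%:C * (cos (complex.Im z) +i* sin (complex.Im z)).

(* Principal power; the convention at 0 is that of [powR]. *)
Definition cpowR z (s : R) : R[i] :=
  if z == 0 then (s == 0)%:R else cexp (s%:C * clog z).

Definition Cintegral d (T : measurableType d)
    (mu : {measure set T -> \bar R}) (f : T -> R[i]) : R[i] :=
  (\int[mu]_x complex.Re (f x)) +i* (\int[mu]_x complex.Im (f x)).

End complex_functions.

Section kappa.
Context {R : realType}.
Local Notation mu := (@lebesgue_measure R).

(* Euler's Gamma function, meaningful for s > 0. *)
Definition Gamma (s : R) : R :=
  \int[mu]_(t in `]0, +oo[) (t `^ (s - 1) * expR (- t)).

(* powR takes junk values at negative arguments, but x * (1 - x) >= 0 on the
   support of the density. *)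
Definition kappa_pdf (lambda : R) : R -> R :=
  (fun x => Gamma lambda / Gamma (lambda / 2) ^+ 2
            * (x * (1 - x)) `^ (lambda / 2 - 1)) \_ `[0, 1].

Definition kappa (lambda : R) : set (measurableTypeR R) -> \bar R :=
  fun A => (\int[mu]_(x in A) (kappa_pdf lambda x)%:E)%E.

Lemma Gamma_ge0 s : 0 <= Gamma s.
Proof.
by apply: Rintegral_ge0 => t _; rewrite mulr_ge0 ?powR_ge0 ?expR_ge0.
Qed.

Lemma kappa_pdf_ge0 lambda x : 0 <= kappa_pdf lambda x.
Proof.
apply: restrict_ge0 => {}x _.
by rewrite mulr_ge0 ?powR_ge0// divr_ge0 ?exprn_ge0 ?Gamma_ge0.
Qed.

Lemma measurable_kappa_pdf lambda :
  measurable_fun [set: R] (kappa_pdf lambda).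
Proof.
apply/measurable_restrict => //; apply: measurable_funTS.
apply: measurable_funM => //.
apply: (@measurableT_comp _ _ _ _ _ _ (fun y : R => y `^ (lambda / 2 - 1))) => //.
by apply: measurable_funM => //; exact: measurable_funB.
Qed.

Section kappa_measure.
Variable lambda : R.

Let kappa0 : kappa lambda set0 = 0%E.
Proof. by rewrite /kappa integral_set0. Qed.

Let kappa_ge0 A : (0 <= kappa lambda A)%E.
Proof. by apply: integral_ge0 => x _; rewrite lee_fin kappa_pdf_ge0. Qed.

Let kappa_sigma_additive : semi_sigma_additive (kappa lambda).
Proof.
move=> /= F mF tF mUF; rewrite /kappa; apply: cvg_toP.
  apply: ereal_nondecreasing_is_cvgn => m n mn.
  apply: lee_sum_nneg_natr => // k _ _; apply: integral_ge0 => /= x Fkx.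
  by rewrite lee_fin kappa_pdf_ge0.
rewrite ge0_integral_bigcup//=.
- apply/measurable_funTS/measurableT_comp => //.
  exact: measurable_kappa_pdf.
- by move=> x _; rewrite lee_fin kappa_pdf_ge0.
Qed.

HB.instance Definition _ := isMeasure.Build _ _ _
  (kappa lambda) kappa0 kappa_ge0 kappa_sigma_additive.

Let kappa_sigma_finite : sigma_finite setT (kappa lambda).
Proof.
pose F n : set R := `[- n%:R, n%:R] `&` kappa_pdf lambda @^-1` `]-oo, n%:R].
have mF n : measurable (F n).
  apply: measurableI => //; rewrite -[X in measurable X]setTI.
  by apply: measurable_kappa_pdf.
exists F; last first.
  move=> n; split; [exact: mF|rewrite /kappa].
  apply: (@le_lt_trans _ _ (\int[mu]_(x in F n) (n%:R%:E))%E).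
    apply: ge0_le_integral => //=.
    - exact: mF.
    - by move=> x _; rewrite lee_fin kappa_pdf_ge0.
    - apply/measurable_funTS/measurableT_comp => //.
      exact: measurable_kappa_pdf.
    - by move=> x [_ /=]; rewrite in_itv/= lee_fin.
  rewrite integral_cst; last exact: mF.
  rewrite lte_mul_pinfty ?lee_fin//.
  apply: (@le_lt_trans _ _ (mu `[- n%:R, n%:R])).
    by apply: le_measure; rewrite ?inE//=; [exact: mF|exact: subIsetl].
  by rewrite lebesgue_measure_itv/=; case: ifPn => // _; rewrite -EFinB ltry.
apply/esym/seteqP; split => // x _.
pose M := Num.max `|x| (kappa_pdf lambda x).
exists (Num.truncn M).+1 => //=.
have ltM : M <= (Num.truncn M).+1%:R by exact/ltW/truncnS_gt.
have : (`|x| <= M) && (kappa_pdf lambda x <= M).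
  by rewrite /M !le_max !lexx orbT.
move=> /andP[xM pM]; split; rewrite /= in_itv/=.
  by rewrite -ler_norml (le_trans xM).
exact: le_trans ltM.
Qed.

HB.instance Definition _ :=
  Measure_isSigmaFinite.Build _ _ _ (kappa lambda) kappa_sigma_finite.

End kappa_measure.

Section mulconv.
Variables (P : {measure set (measurableTypeR R) -> \bar R})
  (Q : {sigma_finite_measure set (measurableTypeR R) -> \bar R}).

Definition mulR2 (uv : measurableTypeR R * measurableTypeR R) :
  measurableTypeR R := uv.1 * uv.2.

Lemma measurable_mulR2 : measurable_fun setT mulR2.
Proof.
by apply: (@measurable_funM _ _ _ _ fst snd);
  [exact: measurable_fst|exact: measurable_snd].
Qed.

(* The law of U * V for independent U and V of laws P and Q: the image of the
   product measure under multiplication. *)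
Definition mulconv := pushforward (P \x Q)%E mulR2.

Let mulconv0 : mulconv set0 = 0%E.
Proof. by rewrite /mulconv /pushforward preimage_set0 measure0. Qed.

Let mulconv_ge0 A : (0 <= mulconv A)%E.
Proof. by rewrite /mulconv /pushforward measure_ge0. Qed.

Let mulconv_sigma_additive : semi_sigma_additive mulconv.
Proof.
move=> F mF tF mUF; rewrite /mulconv /pushforward preimage_bigcup.
apply: measure_semi_sigma_additive.
- by move=> n; rewrite -[X in measurable X]setTI; exact: measurable_mulR2.
- apply/trivIsetP => /= i j _ _ ij; rewrite -preimage_setI.
  by move/trivIsetP : tF => /(_ _ _ _ _ ij) ->//; rewrite preimage_set0.
- rewrite -preimage_bigcup -[X in measurable X]setTI.
  exact: measurable_mulR2.
Qed.

HB.instance Definition _ := isMeasure.Build _ _ _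
  mulconv mulconv0 mulconv_ge0 mulconv_sigma_additive.

End mulconv.

End kappa.

(* Main.v *)
Require Import Defs.
From mathcomp Require Import all_boot all_order all_algebra.
From mathcomp Require Import complex.
From mathcomp Require Import all_classical all_reals all_analysis.
From HB Require Import structures.
From mathcomp Require Import ring lra measurable_realfun.
Import Order.TTheory GRing.Theory Num.Theory.
Import numFieldNormedType.Exports.
Local Open Scope ring_scope.
Local Open Scope complex_scope.

(** Why the formula holds.  Write [a = lambda / 2] and fix [z] with positive
    imaginary part.  For real [t] and [u] the point [z - t u] never leaves the
    upper half-plane, so all powers below are smooth in [t] and [u] and no
    analytic continuation is needed: the identity is moved along the real
    line from [t = 0], where it is trivial, to [t = 1].

    For [kappa] with parameter [l], let [M k s t] be the integral of
    [u^k (z - t u)^(-s)] ([moment]).  Three relations are used: the derivative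
    of [M k s] is [s M (k+1) (s+1)] ([is_cderive_moment]); splitting off one
    factor [z - t u] gives [M k s = z M k (s+1) - t M (k+1) (s+1)]
    ([moment_raise]); and integrating the derivative of
    [(u (1 - u))^(l/2) (z - t u)^(-s)] over [0, 1] gives a linear relation
    between moments ([moment_by_parts]).

    Integrating over the factor of law [kappa l] with [l = 2 a] and [s = 2 a],
    these relations say that [M 0 (2 a) t * (z - t)^a] has zero derivative,
    whence the mean of [(z - t u)^(-2 a)] is [z^(-a) (z - t)^(-a)]
    ([moment_beta]).

    There remains the mean of [(z - v)^(-a)] under [kappa (2 a + 1)].  Put
    [E t = sqrt z + sqrt (z - t)] and [w = t / E t ^ 2].  Then
    [4 (z - t u) / E^2 = 1 - 2 w x + w^2] with [x = 2 u - 1], the generating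
    function of the Gegenbauer polynomials, and [kappa (2 a + 1)] is their
    orthogonality weight; so [f = M 0 a * E^(2 a)], which is [4^a] times the
    mean of [(1 - 2 w x + w^2)^(-a)], should not depend on [w].  Indeed
    [w f'' + (2 a + 1) f' = 0] in the variable [w], by parts; a solution [f']
    that is regular at [0] has to vanish ([euler_ode_eq0]), and [f] is equal to
    its value [4^a] at [t = 0] ([moment_gegenbauer]).

    The normalisation of [kappa] is the identity
    [Gamma a * Gamma b = Gamma (a + b) * B(a, b)] ([gamma_intM]), and Fubini's
    theorem ([Cintegral_mulconv]) combines the two means. *)

Local Notation Re := complex.Re.
Local Notation Im := complex.Im.

(** * The complex exponential, and its logarithm on the upper half-plane *)

Section complex_calculus.
Context {R : realType}.
Implicit Types (z w : R[i]) (f g : R -> R[i]) (t : R).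

Lemma ReD z w : Re (z + w) = Re z + Re w. Proof. by case: z; case: w. Qed.
Lemma ImD z w : Im (z + w) = Im z + Im w. Proof. by case: z; case: w. Qed.
Lemma ReN z : Re (- z) = - Re z. Proof. by case: z. Qed.
Lemma ImN z : Im (- z) = - Im z. Proof. by case: z. Qed.
Lemma ReM z w : Re (z * w) = Re z * Re w - Im z * Im w.
Proof. by case: z; case: w. Qed.
Lemma ImM z w : Im (z * w) = Re z * Im w + Im z * Re w.
Proof. by case: z => a b; case: w => c d. Qed.
Lemma complexP z w : Re z = Re w -> Im z = Im w -> z = w.
Proof. by case: z; case: w => a b c d /= -> ->. Qed.

Lemma ReRM (x : R) z : Re (x%:C * z) = x * Re z.
Proof. by rewrite ReM /= mul0r subr0. Qed.
Lemma ImRM (x : R) z : Im (x%:C * z) = x * Im z.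
Proof. by rewrite ImM /= mul0r addr0. Qed.

Definition complexpE := (ReD, ImD, ReN, ImN, ReM, ImM).

Lemma Im_gt0_neq0 z : 0 < Im z -> z != 0.
Proof. by move=> h; apply/eqP => z0; move: h; rewrite z0 ltxx. Qed.

Lemma ReV z : Re z^-1 = Re z / (Re z ^+ 2 + Im z ^+ 2).
Proof. by case: z. Qed.
Lemma ImV z : Im z^-1 = - (Im z / (Re z ^+ 2 + Im z ^+ 2)).
Proof. by case: z => a b; rewrite /= ?mulNr. Qed.

Lemma cmodE z : cmod z = Num.sqrt (Re z ^+ 2 + Im z ^+ 2).
Proof. by case: z. Qed.

Lemma cexpE z :
  cexp z = (expR (Re z) * cos (Im z)) +i* (expR (Re z) * sin (Im z)).
Proof. by apply: complexP; rewrite ?complexpE /= ?mul0r ?subr0 ?addr0. Qed.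

Lemma Re_cexp z : Re (cexp z) = expR (Re z) * cos (Im z).
Proof. by rewrite cexpE. Qed.

Lemma cexpD z w : cexp (z + w) = cexp z * cexp w.
Proof.
apply: complexP; rewrite !cexpE !complexpE /= expRD ?cosD ?sinD; ring.
Qed.

Lemma cexp0 : cexp 0 = 1 :> R[i].
Proof. by apply: complexP; rewrite cexpE /= expR0 ?cos0 ?sin0; ring. Qed.

Lemma cmod_cexp z : cmod (cexp z) = expR (Re z).
Proof.
rewrite cmodE cexpE /= !exprMn -mulrDr cos2Dsin2 mulr1 sqrtr_sqr.
by rewrite gtr0_norm// expR_gt0.
Qed.

Lemma cexp_neq0 z : cexp z != 0.
Proof.
apply/eqP => z0; have := cmod_cexp z.
by rewrite z0 cmodE /= expr0n /= addr0 sqrtr0 => /esym/eqP; rewrite gt_eqF ?expR_gt0.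
Qed.

Lemma cexpN z : cexp (- z) = (cexp z)^-1.
Proof.
apply: (mulfI (cexp_neq0 z)).
by rewrite -cexpD subrr cexp0 divff// cexp_neq0.
Qed.

Lemma sqr_cmod_gt0 z : 0 < Im z -> 0 < Re z ^+ 2 + Im z ^+ 2.
Proof. by move=> h; rewrite ltr_wpDl ?sqr_ge0 ?exprn_gt0. Qed.

Lemma sin_atan t : sin (atan t) = t / Num.sqrt (1 + t ^+ 2).
Proof.
have c0 : cos (atan t) != 0.
  by rewrite cos_atan invr_eq0 sqrtr_eq0 -ltNge ltr_pwDl ?sqr_ge0.
rewrite -cos_atan; have := atanK t; rewrite /tan => {2}<-.
by rewrite mulfVK.
Qed.

(** The argument is defined through [acos] of a quotient by the modulus.  On the
    upper half-plane it is an arctangent of a rational function, which is far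
    easier to differentiate. *)
Lemma clogE z : 0 < Im z ->
  clog z = (ln (Re z ^+ 2 + Im z ^+ 2) / 2) +i* (pi / 2 - atan (Re z / Im z)).
Proof.
move=> y0; rewrite /clog /carg ltW// cmodE; congr Complex.
  by rewrite -powR12_sqrt ?ltW ?sqr_cmod_gt0// ln_powR mulrC.
have -> : Re z / Num.sqrt (Re z ^+ 2 + Im z ^+ 2) =
          cos (pi / 2 - atan (Re z / Im z)).
  rewrite cosB cos_pihalf sin_pihalf mul0r add0r mul1r sin_atan.
  have -> : 1 + (Re z / Im z) ^+ 2 = (Re z ^+ 2 + Im z ^+ 2) / Im z ^+ 2.
    by field; rewrite gt_eqF.
  rewrite sqrtrM ?addr_ge0 ?sqr_ge0// sqrtrV ?sqr_ge0// sqrtr_sqr gtr0_norm//.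
  by field; rewrite gt_eqF//= sqrtr_eq0 -ltNge sqr_cmod_gt0.
rewrite cosK// in_itv/=.
have := atan_gtNpi2 (Re z / Im z); have := atan_ltpi2 (Re z / Im z).
by move=> h1 h2; apply/andP; split; lra.
Qed.

Lemma Im_clog_gt0 z : 0 < Im z -> 0 < Im (clog z) < pi.
Proof.
move=> y0; rewrite clogE//=.
have := atan_gtNpi2 (Re z / Im z); have := atan_ltpi2 (Re z / Im z).
by move=> h1 h2; apply/andP; split; lra.
Qed.

Lemma clogK z : 0 < Im z -> cexp (clog z) = z.
Proof.
move=> y0; rewrite cexpE clogE//=.
have n0 := sqr_cmod_gt0 _ y0.
have -> : ln (Re z ^+ 2 + Im z ^+ 2) / 2 = ln (Num.sqrt (Re z ^+ 2 + Im z ^+ 2)).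
  by rewrite -powR12_sqrt ?ltW// ln_powR mulrC.
rewrite lnK ?posrE ?sqrtr_gt0//.
rewrite cosB sinB cos_pihalf sin_pihalf !mul0r subr0 add0r !mul1r sin_atan cos_atan.
have -> : 1 + (Re z / Im z) ^+ 2 = (Re z ^+ 2 + Im z ^+ 2) / Im z ^+ 2.
  by field; rewrite gt_eqF.
rewrite sqrtrM ?(ltW n0)// sqrtrV ?sqr_ge0// sqrtr_sqr gtr0_norm//.
by apply: complexP => /=; field; rewrite gt_eqF//= gt_eqF ?sqrtr_gt0.
Qed.

Lemma cexpK z : 0 < Im z < pi -> clog (cexp z) = z.
Proof.
move=> /andP[i0 ipi].
have s0 : 0 < sin (Im z) by rewrite sin_gt0_pi ?i0.
rewrite /clog cmod_cexp expRK /carg cmod_cexp cexpE /= mulr_ge0 ?expR_ge0 1?ltW//.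
rewrite mulrAC divff ?gt_eqF ?expR_gt0// mul1r cosK ?in_itv/= ?ltW//.
by case: z {i0 ipi s0}.
Qed.

Lemma Im_cexp_gt0 z : 0 < Im z < pi -> 0 < Im (cexp z).
Proof. by move=> h; rewrite cexpE /= mulr_gt0 ?expR_gt0// sin_gt0_pi. Qed.

End complex_calculus.

(** * Derivatives along the real line *)

Section real_derivative.
Context {R : realType}.
Implicit Types (f g : R -> R) (t a b : R).

(** Pointwise forms of the differentiation rules, composed by plain
    application: the ones stated for the ring of functions are found by
    instance resolution only when the function is written with them. *)
Lemma is_derive_conv {f t a} b : is_derive t (1 : R) f a -> a = b ->
  is_derive t (1 : R) f b.
Proof. by move=> ? <-. Qed.

Lemma is_derive_sub {f g t a b} : is_derive t (1 : R) f a -> is_derive t (1 : R) g b ->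
  is_derive t (1 : R) (fun x => f x - g x) (a - b).
Proof. by move=> hf hg; exact: is_deriveB. Qed.

Lemma is_derive_add {f g t a b} : is_derive t (1 : R) f a -> is_derive t (1 : R) g b ->
  is_derive t (1 : R) (fun x => f x + g x) (a + b).
Proof. by move=> hf hg; exact: is_deriveD. Qed.

Lemma is_derive_mul {f g t a b} : is_derive t (1 : R) f a -> is_derive t (1 : R) g b ->
  is_derive t (1 : R) (fun x => f x * g x) (a * g t + f t * b).
Proof.
move=> hf hg; have := is_deriveM hf hg; rewrite /GRing.scale /= addrC (mulrC (g t)).
exact.
Qed.

Lemma is_derive_chain {f g t a b} : is_derive t (1 : R) g b -> is_derive (g t) (1 : R) f a ->
  is_derive t (1 : R) (fun x => f (g x)) (a * b).
Proof. by move=> hg hf; exact: is_derive1_comp. Qed.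

Lemma is_derive_const c t : is_derive t (1 : R) (fun=> c : R) 0.
Proof. exact: is_derive_cst. Qed.

Lemma is_derive_continuous (f : R -> R) (t a : R) : is_derive t (1 : R) f a ->
  {for t, continuous f}.
Proof.
move=> h; apply: differentiable_continuous; apply/derivable1_diffP.
exact: ex_derive.
Qed.

End real_derivative.

Section complex_derivative.
Context {R : realType}.
Implicit Types (z w d : R[i]) (f g : R -> R[i]) (t : R).

(** Only derivatives along the real line occur, so a complex function is
    differentiated componentwise rather than over the field [R[i]]. *)
Definition is_cderive f t d :=
  is_derive t (1 : R) (fun x => Re (f x)) (Re d) /\
  is_derive t (1 : R) (fun x => Im (f x)) (Im d).

Lemma is_cderive_eq {f t d} d' : is_cderive f t d -> d = d' -> is_cderive f t d'.
Proof. by move=> ? <-. Qed.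

Lemma is_cderive_cst z t : is_cderive (fun=> z) t 0.
Proof. by split; exact: is_derive_cst. Qed.

Lemma is_cderive_real t : is_cderive (fun x => x%:C) t 1.
Proof. by split; [exact: is_derive_id|exact: is_derive_cst]. Qed.

Lemma is_cderiveD {f g t df dg} : is_cderive f t df -> is_cderive g t dg ->
  is_cderive (fun x => f x + g x) t (df + dg).
Proof.
move=> [f1 f2] [g1 g2]; split; rewrite complexpE.
  by under eq_fun do rewrite complexpE; exact: is_deriveD.
by under eq_fun do rewrite complexpE; exact: is_deriveD.
Qed.

Lemma is_cderiveN {f t df} : is_cderive f t df ->
  is_cderive (fun x => - f x) t (- df).
Proof.
move=> [f1 f2]; split; rewrite complexpE.
  by under eq_fun do rewrite complexpE; exact: is_deriveN.
by under eq_fun do rewrite complexpE; exact: is_deriveN.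
Qed.

Lemma is_cderiveB {f g t df dg} : is_cderive f t df -> is_cderive g t dg ->
  is_cderive (fun x => f x - g x) t (df - dg).
Proof. by move=> hf hg; apply: is_cderiveD => //; exact: is_cderiveN. Qed.

Lemma is_cderiveM {f g t df dg} : is_cderive f t df -> is_cderive g t dg ->
  is_cderive (fun x => f x * g x) t (df * g t + f t * dg).
Proof.
move=> [f1 f2] [g1 g2]; split.
  under eq_fun do rewrite complexpE.
  apply: (is_derive_conv _ (is_derive_sub (is_derive_mul f1 g1) (is_derive_mul f2 g2))).
  by rewrite !complexpE /=; ring.
under eq_fun do rewrite complexpE.
apply: (is_derive_conv _ (is_derive_add (is_derive_mul f1 g2) (is_derive_mul f2 g1))).
by rewrite !complexpE /=; ring.
Qed.

Lemma is_cderiveZ z {f t df} : is_cderive f t df ->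
  is_cderive (fun x => z * f x) t (z * df).
Proof.
move=> hf; apply: is_cderive_eq; first exact: is_cderiveM (is_cderive_cst z t) hf.
by rewrite mul0r add0r.
Qed.

Lemma is_cderive_cexp {f t df} : is_cderive f t df ->
  is_cderive (fun x => cexp (f x)) t (df * cexp (f t)).
Proof.
move=> [f1 f2]; split.
  under eq_fun do rewrite cexpE /=.
  apply: (is_derive_conv _ (is_derive_mul (is_derive_chain f1 (is_derive_expR _)) (is_derive_chain f2 (is_derive_cos _)))).
  by rewrite complexpE cexpE /=; ring.
under eq_fun do rewrite cexpE /=.
apply: (is_derive_conv _ (is_derive_mul (is_derive_chain f1 (is_derive_expR _)) (is_derive_chain f2 (is_derive_sin _)))).
by rewrite complexpE cexpE /=; ring.
Qed.

(** The positivity is asked everywhere, not only at [t], so that the explicit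
    form of the logarithm applies on a whole neighbourhood of [t]. *)
Lemma is_cderive_clog {f t df} : (forall x, 0 < Im (f x)) ->
  is_cderive f t df -> is_cderive (fun x => clog (f x)) t (df / f t).
Proof.
move=> f0 [f1 f2].
have y0 := f0 t; have n0 := sqr_cmod_gt0 _ y0.
have Ny0 : Im (f t) != 0 by rewrite gt_eqF.
split.
  under eq_fun do rewrite clogE//=.
  under eq_fun do rewrite !expr2.
  have p0 : 0 < Re (f t) * Re (f t) + Im (f t) * Im (f t) by rewrite -!expr2.
  have hln := is_derive1_ln p0.
  apply: (is_derive_conv _ (is_derive_mul (is_derive_chain (is_derive_add (is_derive_mul f1 f1) (is_derive_mul f2 f2)) hln)
    (is_derive_const 2^-1 t))).
  rewrite !complexpE ReV ImV /=; field.
  by rewrite gt_eqF.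
under eq_fun do rewrite clogE//=.
apply: (is_derive_conv _ (is_derive_sub (is_derive_const (pi / 2) t)
  (is_derive_chain (is_derive_mul f1 (is_deriveV Ny0 f2)) (is_derive1_atan _)))).
rewrite !complexpE ReV ImV /GRing.scale /=; field.
by apply/andP; split; [exact: lt0r_neq0 n0|exact: Ny0].
Qed.

Lemma cpowRE z (s : R) : 0 < Im z -> cpowR z s = cexp (s%:C * clog z).
Proof. by move=> z0; rewrite /cpowR (negbTE (Im_gt0_neq0 _ z0)). Qed.

Lemma is_cderive_cpowR (s : R) {f t df} : (forall x, 0 < Im (f x)) ->
  is_cderive f t df ->
  is_cderive (fun x => cpowR (f x) s) t (s%:C * df * cpowR (f t) (s - 1)).
Proof.
move=> f0 hf; under eq_fun do rewrite cpowRE//.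
apply: is_cderive_eq.
  exact: is_cderive_cexp (is_cderiveZ _ (is_cderive_clog f0 hf)).
rewrite cpowRE// rmorphB /= mulrBl mul1r cexpD cexpN clogK//; ring.
Qed.

Lemma cpowRD z (s s' : R) : 0 < Im z -> cpowR z (s + s') = cpowR z s * cpowR z s'.
Proof. by move=> z0; rewrite !cpowRE// -cexpD rmorphD mulrDl. Qed.

Lemma cpowRN z (s : R) : 0 < Im z -> cpowR z (- s) = (cpowR z s)^-1.
Proof. by move=> z0; rewrite !cpowRE// -cexpN rmorphN mulNr. Qed.

Lemma cpowR1 z : 0 < Im z -> cpowR z 1 = z.
Proof. by move=> z0; rewrite cpowRE// mul1r clogK. Qed.

Lemma cpowR_pred z (s : R) : 0 < Im z -> cpowR z s = cpowR z (s - 1) * z.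
Proof. by move=> z0; have := cpowRD z (s - 1) 1 z0; rewrite subrK cpowR1. Qed.

Lemma cpowR_neq0 z (s : R) : 0 < Im z -> cpowR z s != 0.
Proof. by move=> z0; rewrite cpowRE// cexp_neq0. Qed.

Lemma norm_Re_le z : `|Re z| <= cmod z.
Proof. by rewrite cmodE -sqrtr_sqr ler_wsqrtr// lerDl sqr_ge0. Qed.

Lemma norm_Im_le z : `|Im z| <= cmod z.
Proof. by rewrite cmodE -sqrtr_sqr ler_wsqrtr// lerDr sqr_ge0. Qed.

(** The uniform bound behind every domination below: a point of the upper
    half-plane is at distance at least its height from the origin. *)
Lemma cmod_cpowRN_le z (s : R) : 0 < Im z -> 0 <= s ->
  cmod (cpowR z (- s)) <= Im z `^ (- s).
Proof.
move=> z0 s0; rewrite cpowRE// cmod_cexp /powR gt_eqF// ler_expR.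
rewrite complexpE /= mul0r subr0 !mulNr lerN2 ler_wpM2l//.
have le : Im z <= cmod z := le_trans (ler_norm _) (norm_Im_le z).
by rewrite ler_ln ?posrE// (lt_le_trans z0).
Qed.

Lemma cmodM z w : cmod (z * w) = cmod z * cmod w.
Proof. exact: ComplexField.Normc.normcM. Qed.

Lemma cmodD_le (z w : R[i]) : cmod (z + w) <= cmod z + cmod w.
Proof. exact: le_normcD. Qed.

Lemma cmod_real (x : R) : cmod x%:C = `|x|.
Proof. by rewrite cmodE /= expr0n /= addr0 sqrtr_sqr. Qed.

Lemma is_cderive_0_is_cst f : (forall t, is_cderive f t 0) ->
  forall x y, f x = f y.
Proof.
move=> h x y; apply: complexP.
  by apply: (@is_derive_0_is_cst R (fun x => Re (f x)) x y) => t; have [] := h t.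
by apply: (@is_derive_0_is_cst R (fun x => Im (f x)) x y) => t; have [] := h t.
Qed.

(** Both sides are square roots of [z], hence equal up to a sign, and neither
    has a negative imaginary part. *)
Lemma sqrtcE z : 0 < Im z -> sqrtc z = cexp (clog z / 2).
Proof.
move=> z0; have : sqrtc z ^+ 2 == cexp (clog z / 2) ^+ 2.
  by rewrite sqr_sqrtc expr2 -cexpD -splitr clogK.
rewrite eqf_sqr => /orP[/eqP//|/eqP h].
have := Im_clog_gt0 _ z0 => /andP[c0 cpi].
have I0 : 0 < Im (cexp (clog z / 2)).
  apply: Im_cexp_gt0; rewrite mulrC complexpE.
  have -> : (2^-1 : R[i]) = (2^-1)%:C by rewrite fmorphV rmorph_nat.
  rewrite [Re _]/= [Im (_)%:C]/= mul0r addr0.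
  by apply/andP; split; lra.
have : 0 <= Im (sqrtc z).
  move: z0; case: z {h c0 cpi I0} => a b /= b0.
  rewrite gt_eqF// gtr0_sg// mul1r sqrtr_ge0//.
by rewrite h complexpE oppr_ge0 leNgt I0.
Qed.

End complex_derivative.

(** * The Beta integral in terms of Gamma *)

Section affine_substitution.
Local Open Scope classical_set_scope.
Context {R : realType}.
Local Notation mu := (@lebesgue_measure R).
Variables c d : R.
Hypothesis c_gt0 : 0 < c.

Let phi (x : measurableTypeR R) : measurableTypeR R := c * x + d.

Let mphi : measurable_fun setT phi.
Proof. by apply: measurable_funD => //; exact: measurable_funM. Qed.

Let nu : {measure set (measurableTypeR R) -> \bar R} :=
  measure_function_pushforward__canonical__measure_function_Measure mu mphi.

Let mu_nu A : measurable A -> mu A = mscale (NngNum (ltW c_gt0)) nu A.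
Proof.
apply: lebesgue_measure_unique => _ [[a b] _ <-]/=.
rewrite /mscale/= /pushforward.
have -> : phi @^-1` `]a, b] = `](a - d) / c, (b - d) / c].
  apply/seteqP; split=> x /=; rewrite !in_itv/= /phi.
    by rewrite ltr_pdivrMr// ler_pdivlMr// ltrBlDr lerBrDr mulrC.
  by rewrite ltr_pdivrMr// ler_pdivlMr// ltrBlDr lerBrDr (mulrC x).
rewrite !lebesgue_measure_itv/= !lte_fin ltr_pM2r ?invr_gt0// ltrD2r.
case: ifP => _; last by rewrite mule0.
by rewrite -!EFinB -EFinM; congr EFin; field; rewrite gt_eqF.
Qed.

(** The image of Lebesgue measure under [x |-> c x + d], scaled by [c], gives
    intervals their length, hence is Lebesgue measure.  An argument on measures
    covers the integrands below, which may blow up at end points. *)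
Lemma ge0_integral_affine (f : R -> \bar R) :
  measurable_fun setT f -> (forall x, 0 <= f x)%E ->
  (\int[mu]_x f x = c%:E * \int[mu]_x f (c * x + d)%R)%E.
Proof.
move=> mf f0.
rewrite (eq_measure_integral (mscale (NngNum (ltW c_gt0)) nu)); last first.
  by move=> A mA _; exact: mu_nu.
rewrite ge0_integral_mscale//=; congr (_ * _)%E.
by rewrite ge0_integral_pushforward.
Qed.

End affine_substitution.

Section gamma_beta.
Local Open Scope classical_set_scope.
Context {R : realType}.
Local Notation mu := (@lebesgue_measure R).
Implicit Types (a b t x : R).

(** Extending [t^(a - 1)] by zero to the whole line turns the Gamma and Beta
    integrals into integrals over [R], in which affine substitutions require no
    bookkeeping of domains. *)
Definition pos_powR a t : R := if 0 < t then t `^ (a - 1) else 0.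

Lemma pos_powR_ge0 a t : 0 <= pos_powR a t.
Proof. by rewrite /pos_powR; case: ifP => // _; exact: powR_ge0. Qed.

Lemma measurable_pos_powR a : measurable_fun setT (pos_powR a).
Proof.
apply: measurable_fun_ifT => //; apply: (measurable_fun_bool true).
rewrite (_ : _ @^-1` _ = `]0, +oo[) ?setTI//.
by apply/seteqP; split => x /=; rewrite in_itv/= andbT.
Qed.

Lemma pos_powR_homogeneous a x t : 0 < x -> pos_powR a (x * t) = x `^ (a - 1) * pos_powR a t.
Proof.
move=> x0; rewrite /pos_powR pmulr_rgt0//; case: ifPn => [t0|_]; last by rewrite mulr0.
by rewrite powRM// ltW.
Qed.

Definition gamma_int a := (\int[mu]_t (pos_powR a t * expR (- t))%:E)%E.

Definition beta_int a b := (\int[mu]_x (pos_powR a x * pos_powR b (1 - x))%:E)%E.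

(** Tonelli: in the double integral of [t^(a-1) s^(b-1) e^(-t-s)] substitute
    [r = s + t] for [s], exchange the integrals, and substitute [t = r x]; the
    powers of [r] then factor out as [r^(a+b-1)].  The identity holds in the
    extended reals, so finiteness can be dealt with afterwards. *)
Lemma gamma_intM a b : (gamma_int a * gamma_int b = beta_int a b * gamma_int (a + b))%E.
Proof.
have mg c : measurable_fun setT (fun t : measurableTypeR R => pos_powR c t * expR (- t)).
  apply: measurable_funM; first exact: measurable_pos_powR.
  exact: measurableT_comp.
have mg1 c r : measurable_fun setT (fun t : measurableTypeR R => pos_powR c (r - t)).
  by apply: measurableT_comp; [exact: measurable_pos_powR|exact: measurable_funB].
have g0 c t : (0 <= (pos_powR c t * expR (- t))%:E)%E.
  by rewrite lee_fin mulr_ge0 ?pos_powR_ge0 ?expR_ge0.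
pose F (z : measurableTypeR R * measurableTypeR R) : \bar R :=
  (pos_powR a z.1 * pos_powR b (z.2 - z.1) * expR (- z.2))%:E.
have mF : measurable_fun setT F.
  apply/measurable_EFinP; apply: measurable_funM; last first.
    by apply: measurableT_comp => //; exact: measurableT_comp.
  apply: measurable_funM.
    by apply: measurableT_comp; [exact: measurable_pos_powR|exact: measurable_fst].
  apply: (@measurableT_comp _ _ _ _ _ _ (pos_powR b)); first exact: measurable_pos_powR.
  by apply: measurable_funB; [exact: measurable_snd|exact: measurable_fst].
have F0 z : (0 <= F z)%E by rewrite lee_fin !mulr_ge0 ?pos_powR_ge0 ?expR_ge0.
transitivity (\int[mu]_t \int[mu]_r F (t, r))%E.
  rewrite -ge0_integralZr//; last 2 first.
  - exact/measurable_EFinP.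
  - by apply: integral_ge0 => t _; exact: g0.
  apply: eq_integral => t _.
  rewrite -ge0_integralZl//; last exact/measurable_EFinP.
  rewrite [RHS](_ : _ = \int[mu]_s (fun r => F (t, r)) (1 * s + t)%R)%E; last first.
    rewrite [LHS](ge0_integral_affine 1 t ltr01) ?mul1e//.
    exact: measurableT_comp mF _.
  apply: eq_integral => s _; rewrite /F/= mul1r addrK -EFinM; congr EFin.
  by rewrite opprD expRD; ring.
rewrite (fubini_tonelli F mF F0).
rewrite -ge0_integralZl//; last 2 first.
- exact/measurable_EFinP.
- by apply: integral_ge0 => x _; rewrite lee_fin mulr_ge0 ?pos_powR_ge0.
apply: eq_integral => r _; rewrite muleC.
(* For [r <= 0] one of [t] and [r - t] is never positive. *)
have [r0|r0] := ltP 0 r; last first.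
  rewrite {1}/pos_powR ltNge r0/= mul0r mul0e integral0_eq// => t _.
  rewrite /F/= /pos_powR subr_gt0; case: ifPn => t0; last by rewrite !mul0r.
  by rewrite ltNge (le_trans r0 (ltW t0))/= mulr0 mul0r.
rewrite (ge0_integral_affine r 0 r0)//; last exact: measurableT_comp mF _.
rewrite -!ge0_integralZl//; last 4 first.
- apply/measurable_EFinP; apply: measurable_funM; first exact: measurable_pos_powR.
  exact: mg1.
- by move=> x _; rewrite lee_fin mulr_ge0 ?pos_powR_ge0.
- apply: measurableT_comp mF _; apply: measurable_fun_pair => //.
  by apply: measurable_funD => //; exact: measurable_funM.
- by rewrite lee_fin ltW.
apply: eq_integral => x _; rewrite /F/= -!EFinM; congr EFin.
have -> : r - (r * x + 0) = r * (1 - x) by rewrite addr0 mulrBr mulr1.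
rewrite addr0 !pos_powR_homogeneous// {3}/pos_powR r0.
have -> : a + b - 1 = (a - 1) + (b - 1) + 1 by ring.
have rD (p q : R) : r `^ (p + q) = r `^ p * r `^ q.
  by apply: powRD; rewrite (lt0r_neq0 r0) implybT.
by rewrite (rD (a - 1 + (b - 1)) 1) (rD (a - 1) (b - 1)) powRr1 ?(ltW r0)//; ring.
Qed.

(** From [ln y <= y] at [y = t / (2 a)]. *)
Lemma powR_le_expR a t : 0 < a -> 0 < t ->
  t `^ a <= (2 * a) `^ a * expR (t / 2).
Proof.
move=> a0 t0; have a20 : 0 < 2 * a by rewrite mulr_gt0.
rewrite /powR !gt_eqF// -expRD ler_expR.
suff : ln t <= ln (2 * a) + t / (2 * a).
  move=> /(ler_wpM2l (ltW a0)) /le_trans; apply.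
  by rewrite le_eqVlt; apply/orP; left; apply/eqP; field; rewrite gt_eqF.
rewrite -lerBlDl -ln_div// -ler_expR lnK ?posrE ?divr_gt0//.
by apply: le_trans (expR_ge1Dx _); rewrite lerDr.
Qed.

Lemma gamma_int_ge0 a : (0 <= gamma_int a)%E.
Proof.
by apply: integral_ge0 => t _; rewrite lee_fin mulr_ge0 ?pos_powR_ge0 ?expR_ge0.
Qed.

Lemma beta_int_ge0 a b : (0 <= beta_int a b)%E.
Proof. by apply: integral_ge0 => t _; rewrite lee_fin mulr_ge0 ?pos_powR_ge0. Qed.

(** On [1, 2] the integrand is at least [e^(-2) / 2]. *)
Lemma gamma_int_gt0 a : 0 < a -> (0 < gamma_int a)%E.
Proof.
move=> a0; pose m : R := 2^-1 * expR (- 2).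
have m0 : 0 < m by rewrite mulr_gt0 ?expR_gt0.
have key t : 1 <= t -> t <= 2 -> 2^-1 <= pos_powR a t.
  move=> t1 t2; have t0 : 0 < t by lra.
  rewrite /pos_powR t0.
  have -> : t `^ (a - 1) = t `^ a / t.
    by rewrite powRB ?powRr1 ?(lt0r_neq0 t0) ?implybT// ltW.
  rewrite ler_pdivlMr//.
  apply: (@le_trans _ _ 1); first lra.
  have -> : 1 = 1 `^ a :> R by rewrite powR1.
  by rewrite ge0_ler_powR// ?ltW// nnegrE ltW.
apply: (@lt_le_trans _ _ (\int[mu]_(t in `[1%R, 2%R]) m%:E)%E).
  rewrite integral_cst//= lebesgue_measure_itv/= lte_fin ltr1n -EFinD.
  by rewrite -EFinM lte_fin mulr_gt0//; lra.
apply: (@le_trans _ _ (\int[mu]_(t in `[1%R, 2%R]) (pos_powR a t * expR (- t))%:E)%E).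
  apply: ge0_le_integral => //=.
  - by move=> x _; rewrite lee_fin ltW.
  - apply/measurable_EFinP; apply: measurable_funTS.
    apply: measurable_funM; first exact: measurable_pos_powR.
    exact: measurableT_comp.
  - move=> t; rewrite in_itv/= => /andP[t1 t2]; rewrite lee_fin.
    by apply: ler_pM; rewrite ?expR_ge0 ?invr_ge0// ?ler_expR ?lerN2//; exact: key.
apply: ge0_subset_integral => //.
- apply/measurable_EFinP.
  apply: measurable_funM; first exact: measurable_pos_powR.
  exact: measurableT_comp.
- by move=> t _; rewrite lee_fin mulr_ge0 ?pos_powR_ge0 ?expR_ge0.
Qed.

Lemma GammaE a : Gamma a = fine (gamma_int a).
Proof.
rewrite /Gamma Rintegral_mkcond /Rintegral; congr fine; apply: eq_integral => t _.
rewrite patchE; congr EFin; rewrite /pos_powR.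
case: ifPn; rewrite ?notin_setE ?inE /= in_itv/= andbT; first by move=> ->.
by move=> /negP/negbTE ->; rewrite mul0r.
Qed.

End gamma_beta.

Section ftc.
Local Open Scope classical_set_scope.
Context {R : realType}.
Local Notation mu := (@lebesgue_measure R).

Lemma integral_derive_segment (f F : R -> R) (a b : R) : a < b ->
  (forall x, a <= x <= b -> is_derive x (1 : R) F (f x)) ->
  (forall x, a <= x <= b -> {for x, continuous f}) ->
  (\int[mu]_(x in `[a, b]) (f x)%:E = (F b - F a)%:E)%E.
Proof.
move=> ab hF cf; rewrite (@continuous_FTC2 _ _ F)//.
- by apply: continuous_in_subspaceT => x; rewrite inE/= in_itv/=; exact: cf.
- split.
  + move=> x /subset_itv_oo_cc; rewrite /= in_itv/= => xab.
    by have h := hF x xab; exact: ex_derive.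
  + by apply/cvg_at_right_filter/(is_derive_continuous F a (f a))/hF; rewrite lexx ltW.
  + by apply/cvg_at_left_filter/(is_derive_continuous F b (f b))/hF; rewrite lexx ltW.
- move=> x /subset_itv_oo_cc; rewrite /= in_itv/= => xab; have ? := hF x xab.
  by rewrite derive1E derive_val.
Qed.

(** Exhausting the half-line by compact intervals avoids any discussion of
    limits of [F] at [0] and at infinity. *)
Lemma integral_derive_halfline_le (f F : R -> R) (M : R) :
  (forall x : R, 0 < x -> 0 <= f x) ->
  (forall x : R, 0 < x -> {for x, continuous f}) ->
  (forall x : R, 0 < x -> is_derive x (1 : R) F (f x)) ->
  (forall x : R, 0 < x -> 0 <= F x <= M) ->
  (\int[mu]_(x in `]0%R, +oo[) (f x)%:E <= M%:E)%E.
Proof.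
move=> f0 cf hF FM.
pose D (n : nat) : set R := `[n.+1%:R^-1, n.+2%:R].
have D0 n x : D n x -> 0 < x.
  by rewrite /D/= in_itv/= => /andP[+ _]; apply: lt_le_trans; rewrite invr_gt0.
have UD : \bigcup_n D n = `]0, +oo[.
  apply/seteqP; split=> x /=; first by move=> [n _ /D0]; rewrite in_itv/= andbT.
  rewrite in_itv/= andbT => x0.
  pose m := Num.max x x^-1; exists (Num.truncn m) => //=.
  have h := ltW (truncnS_gt m); rewrite /D/= in_itv/=; apply/andP; split.
    rewrite invf_ple ?posrE//; apply: le_trans h.
    by rewrite /m le_max lexx orbT.
  apply: le_trans (le_trans h _); first by rewrite /m le_max lexx.
  by rewrite ler_nat.
have ndD : nondecreasing_seq D.
  apply/nondecreasing_seqP => n; rewrite subsetEset => x; rewrite /D/= !in_itv/=.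
  move=> /andP[h1 h2]; apply/andP; split; last by rewrite (le_trans h2)// ler_nat.
  by apply: le_trans h1; rewrite lef_pV2 ?posrE// ler_nat.
rewrite -UD; have mf : measurable_fun (`]0, +oo[ : set R) (EFin \o f).
  apply/measurable_EFinP; apply: open_continuous_measurable_fun => // x.
  by rewrite inE/= in_itv/= andbT; exact: cf.
have cvgD : (\int[mu]_(x in D i) (f x)%:E)%E @[i --> \oo] -->
            (\int[mu]_(x in \bigcup_i D i) (f x)%:E)%E.
  apply: ge0_nondecreasing_set_cvg_integral => //.
  - by move=> n; exact: measurable_itv.
  - move=> n; apply: measurable_funS mf => // x /D0.
    by rewrite /= in_itv/= andbT.
  - by move=> n x /D0 x0; rewrite lee_fin f0.
rewrite -(cvg_lim _ cvgD)//; apply: lime_le; first by apply/cvg_ex; eexists; exact: cvgD.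
apply: nearW => n.
have lt : n.+1%:R^-1 < n.+2%:R :> R.
  apply: (@le_lt_trans _ _ 1); first by rewrite invf_le1// ler1n.
  by rewrite ltr1n.
have Dh (x : R) : n.+1%:R^-1 <= x <= n.+2%:R -> 0 < x.
  by move=> xn; apply: (D0 n); rewrite /D/= in_itv.
rewrite (integral_derive_segment f F _ _ lt (fun x xn => hF x (Dh x xn))
  (fun x xn => cf x (Dh x xn))).
rewrite lee_fin lerBlDr.
have /andP[_ /le_trans->//] : 0 <= F n.+2%:R <= M by exact: FM.
by rewrite lerDl; have /andP[] : 0 <= F n.+1%:R^-1 <= M by rewrite FM ?invr_gt0.
Qed.

End ftc.

Section gamma_finite.
Local Open Scope classical_set_scope.
Context {R : realType}.
Local Notation mu := (@lebesgue_measure R).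
Implicit Types (a b t x : R).

(** Both ends are handled by one comparison: up to a constant the integrand is
    dominated by [a t^(a-1) / (1 + t^a)^2], the derivative of the bounded
    function [1 - 1 / (1 + t^a)], because [1 + t^a] is at most a multiple of
    [e^(t/2)]. *)
Lemma gamma_int_lty a : 0 < a -> (gamma_int a < +oo)%E.
Proof.
move=> a0; set K := 1 + (2 * a) `^ a.
have K1 : 1 <= K by rewrite lerDl powR_ge0.
pose F t := K ^+ 2 / a * (1 - (1 + t `^ a)^-1).
pose f t := K ^+ 2 / a * (a * t `^ (a - 1) / (1 + t `^ a) ^+ 2).
have p0 t : 0 < 1 + t `^ a by rewrite ltr_pwDl ?powR_ge0.
have f0 t : 0 <= f t.
  apply: mulr_ge0; first by apply: divr_ge0; [exact: sqr_ge0|exact: ltW].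
  apply: divr_ge0; last exact: sqr_ge0.
  by apply: mulr_ge0; [exact: ltW|exact: powR_ge0].
have hp t : 0 < t -> is_derive t (1 : R) (fun x => 1 + x `^ a) (a * t `^ (a - 1)).
  move=> t0; apply: (is_derive_conv _ (is_derive_add (is_derive_const 1 t) (is_derive1_powR a t0))).
  by rewrite add0r.
have hF t : 0 < t -> is_derive t (1 : R) F (f t).
  move=> t0; have t1 := hp t t0.
  have n0 : 1 + t `^ a != 0 by rewrite gt_eqF.
  apply: (is_derive_conv _ (is_derive_mul (is_derive_const (K ^+ 2 / a) t) (is_derive_sub (is_derive_const 1 t)
    (@is_deriveV _ (fun x : R => 1 + x `^ a) t _ 1 n0 t1)))).
  by rewrite /GRing.scale /= mul0r add0r sub0r /f mulNr opprK; congr (_ * _); rewrite mulrC.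
have cf x : 0 < x -> {for x, continuous f}.
  move=> x0; apply: cvgM; first exact: cvg_cst.
  have px : {for x, continuous (fun t => t `^ (a - 1))}.
    exact: is_derive_continuous (is_derive1_powR (a - 1) x0).
  apply: cvgM; first by apply: cvgM; [exact: cvg_cst|exact: px].
  apply: cvgV; first by rewrite gt_eqF ?exprn_gt0.
  have h1 : {for x, continuous (fun t => 1 + t `^ a)} := is_derive_continuous _ _ _ (hp x x0).
  under eq_fun do rewrite expr2.
  by rewrite expr2; apply: cvgM; exact: h1.
apply: (@le_lt_trans _ _ (K ^+ 2 / a)%:E); last by rewrite ltry.
apply: le_trans (integral_derive_halfline_le f F (K ^+ 2 / a) _ _ hF _).
- rewrite [leRHS]integral_mkcond; apply: ge0_le_integral => //.
  + by move=> t _; rewrite lee_fin mulr_ge0 ?pos_powR_ge0 ?expR_ge0.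
  + apply/measurable_EFinP; apply: measurable_funM; first exact: measurable_pos_powR.
    exact: measurableT_comp.
  + apply/(measurable_restrictT _ _).1 => //; apply/measurable_EFinP; apply: open_continuous_measurable_fun => // x.
    by rewrite inE/= in_itv/= andbT; exact: cf.
  + move=> t _; rewrite patchE /pos_powR mem_setE in_itv/= andbT.
    case: ifPn => t0; last by rewrite mul0r.
    rewrite lee_fin /f mulrA mulrA divfK ?gt_eqF//.
    rewrite -mulrA mulrCA ler_wpM2l ?powR_ge0// expRN.
    have e0 : 0 < expR t by exact: expR_gt0.
    rewrite ler_pdivlMr ?exprn_gt0// mulrC ler_pdivrMr//.
    have -> : expR t = expR (t / 2) ^+ 2 by rewrite -expRM_natl mulrC divfK.
    rewrite -exprMn ler_pXn2r ?nnegrE ?(ltW (p0 t)) ?mulr_ge0 ?expR_ge0 ?(le_trans _ K1)//.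
    rewrite /K mulrDl mul1r lerD ?powR_le_expR//.
    by rewrite -expR0 ler_expR divr_ge0// ltW.
- by [].
- exact: cf.
- move=> x _; rewrite /F.
  have h0 : 0 <= K ^+ 2 / a by rewrite divr_ge0 ?sqr_ge0 ?ltW.
  have h1 : (1 + x `^ a)^-1 <= 1 by rewrite invf_le1// lerDl powR_ge0.
  rewrite mulr_ge0 ?subr_ge0//= -[leRHS]mulr1 ler_wpM2l//.
  by rewrite gerBl invr_ge0 ltW.
Qed.

Lemma Gamma_gt0 a : 0 < a -> 0 < Gamma a.
Proof.
by move=> a0; rewrite GammaE fine_gt0// gamma_int_gt0 ?gamma_int_lty.
Qed.

Lemma gamma_intE a : 0 < a -> gamma_int a = (Gamma a)%:E.
Proof.
move=> a0; rewrite GammaE fineK// ge0_fin_numE ?gamma_int_lty//.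
exact: gamma_int_ge0.
Qed.

Lemma beta_intE a b : 0 < a -> 0 < b ->
  beta_int a b = (Gamma a * Gamma b / Gamma (a + b))%:E.
Proof.
move=> a0 b0; have ab0 : 0 < a + b by rewrite addr_gt0.
have := gamma_intM a b; rewrite !gamma_intE//.
have := Gamma_gt0 (a + b) ab0; have := beta_int_ge0 a b.
case: (beta_int a b) => [r| |]//.
  rewrite lee_fin => r0 g0 [/esym h]; congr EFin.
  by rewrite -[LHS](mulfK (lt0r_neq0 g0)) h.
by move=> _ g0; rewrite gt0_mulye ?lte_fin.
Qed.

Lemma kappa_setT (lambda : R) : 0 < lambda -> @kappa R lambda setT = 1%E.
Proof.
move=> l0; have h0 : 0 < lambda / 2 by rewrite divr_gt0.
set c := Gamma lambda / Gamma (lambda / 2) ^+ 2.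
have c0 : 0 <= c by rewrite divr_ge0 ?exprn_ge0 ?Gamma_ge0.
transitivity (c%:E * beta_int (lambda / 2) (lambda / 2))%E; last first.
  rewrite beta_intE// -splitr -EFinM; congr EFin; rewrite /c.
  have g1 := lt0r_neq0 (Gamma_gt0 _ l0); have g2 := lt0r_neq0 (Gamma_gt0 _ h0).
  by field; rewrite g1 g2.
pose w (x : R) := c * (x * (1 - x)) `^ (lambda / 2 - 1).
have mw : measurable_fun setT (EFin \o w).
  apply/measurable_EFinP; apply: measurable_funM => //.
  apply: (@measurableT_comp _ _ _ _ _ _ (fun y : R => y `^ (lambda / 2 - 1))) => //.
  by apply: measurable_funM => //; exact: measurable_funB.
transitivity (\int[mu]_(x in `[0%R, 1%R]) (w x)%:E)%E.
  rewrite /kappa [RHS]integral_mkcond; apply: eq_integral => x _.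
  by rewrite restrict_EFin.
rewrite integral_itv_bndoo; last exact: measurable_funTS.
rewrite integral_mkcond /beta_int -ge0_integralZl//; last 2 first.
- apply/measurable_EFinP; apply: measurable_funM; first exact: measurable_pos_powR.
  by apply: measurableT_comp; [exact: measurable_pos_powR|exact: measurable_funB].
- by move=> x _; rewrite lee_fin mulr_ge0 ?pos_powR_ge0.
apply: eq_integral => x _; rewrite patchE /pos_powR subr_gt0.
case: ifPn; rewrite ?notin_setE ?inE /= in_itv/=.
  by move=> /andP[x0 x1]; rewrite x0 x1 -EFinM /w powRM ?subr_ge0// ltW.
move=> h; case: ifPn => x0; last by rewrite mul0r mule0.
case: ifPn => x1; last by rewrite mulr0 mule0.
by case: h; rewrite x0 x1.
Qed.

End gamma_finite.

(** * Integration against kappa *)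

Section kappa_density.
Local Open Scope classical_set_scope.
Context {R : realType}.
Local Notation mu := (@lebesgue_measure R).
Variable lambda : R.
Hypothesis lambda_gt0 : 0 < lambda.
Local Notation k := (@kappa R lambda).

Lemma kappa_le1 A : measurable A -> (k A <= 1)%E.
Proof.
by move=> mA; rewrite -(kappa_setT lambda lambda_gt0) le_measure ?inE.
Qed.

Lemma kappa_fin : fin_num_fun k.
Proof.
by move=> A mA; rewrite ge0_fin_numE// (le_lt_trans (kappa_le1 A mA))// ltry.
Qed.

Lemma kappa_dominates : k `<< mu.
Proof.
apply/null_content_dominatesP => A mA A0; rewrite /kappa.
apply: null_set_integral => //; apply/measurable_EFinP/measurable_funTS.
exact: measurable_kappa_pdf.
Qed.

Lemma integrable_kappa_pdf : mu.-integrable setT (EFin \o kappa_pdf lambda).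
Proof.
apply/integrableP; split.
  by apply/measurable_EFinP; exact: measurable_kappa_pdf.
under eq_integral => x _.
  rewrite /= ger0_norm; last exact: kappa_pdf_ge0.
  over.
by have := kappa_setT lambda lambda_gt0; rewrite /kappa => ->; rewrite ltry.
Qed.

(** The density of [kappa] is almost everywhere its Radon-Nikodym derivative,
    since both have the same integrals over measurable sets. *)
Lemma integral_kappa D (f : R -> \bar R) : measurable D ->
  k.-integrable D f ->
  (\int[k]_(x in D) f x = \int[mu]_(x in D) (f x * (kappa_pdf lambda x)%:E))%E.
Proof.
move=> mD intf.
pose k' := HB.pack_for (FiniteMeasure.type (measurableTypeR R) R) k
  (isFinite.Build _ _ _ k kappa_fin).
have dom : k' `<< mu by exact: kappa_dominates.
rewrite -(@Radon_Nikodym_change_of_variables _ _ _ k' mu dom _ _ mD intf).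
pose g := Radon_Nikodym (charge_of_finite_measure k') mu.
have mg : mu.-integrable setT g by exact: Radon_Nikodym_integrable.
have mpdf : measurable_fun setT (EFin \o kappa_pdf lambda).
  by apply/measurable_EFinP; exact: measurable_kappa_pdf.
apply: ae_eq_integral => //.
- apply: emeasurable_funM; first exact: measurable_int intf.
  exact: measurable_funTS (measurable_int _ mg).
- apply: emeasurable_funM; first exact: measurable_int intf.
  exact: measurable_funTS.
- apply: ae_eqe_mul2l; apply: integral_ae_eq => //.
  + exact: integrableS mg.
  + exact: measurable_funTS.
  + by move=> E _ mE; rewrite -Radon_Nikodym_integral.
Qed.

End kappa_density.

(** * Calculus with integrals *)

Section ftc_integrable.
Local Open Scope classical_set_scope.
Context {R : realType}.
Local Notation mu := (@lebesgue_measure R).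

(** The fundamental theorem of calculus for a derivative that is integrable but
    possibly unbounded at the end points: [G] and the indefinite integral of
    [g] are continuous on the closed interval with equal derivatives inside. *)
Lemma Rintegral_derive (g G : R -> R) (a b : R) : a < b ->
  mu.-integrable `[a, b] (EFin \o g) ->
  {within `[a, b], continuous G} ->
  (forall x, a < x < b -> is_derive x (1 : R) G (g x)) ->
  (forall x, a < x < b -> {for x, continuous g}) ->
  \int[mu]_(x in `[a, b]) g x = G b - G a.
Proof.
move=> ab intg cG hG cg.
pose P x := \int[mu]_(t in `[a, x]) g t.
have cP : {within `[a, b], continuous P}.
  exact: parameterized_integral_continuous (ltW ab) intg.
have hP x : a < x < b -> is_derive x (1 : R) P (g x).
  move=> axb; have /andP[ax xb] := axb.
  have [dP <-] := continuous_FTC1_closed xb intg ax (cg x axb).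
  by rewrite derive1E; exact: derivableP.
have hPG x : x \in `]a, b[%R -> is_derive x (1 : R) (fun x => P x - G x) 0.
  by rewrite in_itv/= => xab; apply: (is_derive_conv _ (is_derive_sub (hP x xab) (hG x xab))); rewrite subrr.
have cPG : {within `[a, b], continuous (fun x => P x - G x)}.
  by move=> x; apply: cvgB; [exact: cP|exact: cG].
have [c cab] := @MVT R (fun x => P x - G x) (fun=> 0) a b ab hPG cPG.
rewrite mul0r {2}/P set_itv1 Rintegral_set1 sub0r => /eqP.
by rewrite opprK addrAC -/(P b) subr_eq0 => /eqP; rewrite -/(P b); lra.
Qed.

End ftc_integrable.

Section bounded.
Local Open Scope classical_set_scope.
Context {R : realType}.

Lemma bounded_continuous_segment (f : R -> R) (a b : R) : continuous f ->
  exists2 M : R, 0 <= M & forall x, a <= x <= b -> `|f x| <= M.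
Proof.
move=> cf.
have cf' : {within `[a, b], continuous f} by exact: continuous_subspaceT.
have /compact_bounded[M [_ Mf]] := continuous_compact cf' (@segment_compact _ a b).
exists (`|M| + 1); first by rewrite addr_ge0.
move=> x xab; apply: (Mf (`|M| + 1)); first by rewrite ltr_pwDr// ler_norm.
by exists x => //=; rewrite in_itv.
Qed.

Lemma bounded_on_le (T : Type) (f : T -> R) (D : set T) (M : R) :
  (forall x, D x -> `|f x| <= M) -> [bounded f x | x in D].
Proof.
move=> fM; exists M; split; first exact: num_real.
by move=> x Mx y Dy /=; rewrite (le_trans (fM y Dy))// ltW.
Qed.

Lemma cvg_powR0 (T : Type) (F : set_system T) {FF : Filter F} (v : T -> R) (b : R) :
  0 < b -> (\forall x \near F, 0 <= v x) -> v x @[x --> F] --> 0 ->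
  v x `^ b @[x --> F] --> 0.
Proof.
move=> b0 v0 cv; apply/cvgr0Pnorm_lt => e e0.
have d0 : 0 < e `^ b^-1 by rewrite powR_gt0.
near=> x.
have vx0 : 0 <= v x by near: x.
have vxd : v x < e `^ b^-1.
  have : `|v x| < e `^ b^-1 by near: x; exact: (cvgr0_norm_lt _ cv).
  by rewrite ger0_norm.
rewrite ger0_norm ?powR_ge0//.
apply: (lt_le_trans (gt0_ltr_powR b0 _ _ vxd)); rewrite ?nnegrE ?powR_ge0//.
by rewrite -powRrM mulVf ?gt_eqF// powRr1// ltW.
Unshelve. all: by end_near. Qed.

End bounded.

Section differentiation.
Local Open Scope classical_set_scope.
Context {R : realType} {d} {T : measurableType d} (m : {measure set T -> \bar R}).

Lemma is_derive_Rintegral (D : set T) (f f' : R -> T -> R) (C : R) (t : R) :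
  measurable D -> (m D < +oo)%E ->
  (forall x u, D u -> is_derive x (1 : R) (f^~ u) (f' x u)) ->
  (forall x, measurable_fun D (f x)) ->
  (forall x u, D u -> `|f x u| <= C) ->
  (forall x u, D u -> `|f' x u| <= C) ->
  is_derive t (1 : R) (fun x => \int[m]_(u in D) f x u) (\int[m]_(u in D) f' t u).
Proof.
move=> mD mDoo hf mf fC f'C.
have tI : (`]t - 1, t + 1[ : set R) t by rewrite /= in_itv/= ltrBlDr ltrDl ltr01.
have intf x : m.-integrable D (EFin \o f x).
  by apply: measurable_bounded_integrable => //; exact: bounded_on_le (fC x).
have d1 x u : D u -> partial1of2 f x u = f' x u.
  by move=> Du; have h := hf x u Du; rewrite /partial1of2 derive1E derive_val.
have dv x y : (`]t - 1, t + 1[ : set R) x -> D y -> derivable (f ^~ y) x 1.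
  by move=> _ Dy; have h := hf x y Dy; exact: ex_derive.
have iG : m.-integrable D (EFin \o cst `|C|).
  by apply: measurable_bounded_integrable => //; exact: bounded_cst.
have ub x y : (`]t - 1, t + 1[ : set R) x -> D y -> `|partial1of2 f x y| <= cst `|C| y.
  by move=> _ Dy; rewrite d1// (le_trans (f'C _ _ Dy))// ler_norm.
have G0 (y : T) : 0 <= cst `|C| y by [].
have ex := @derivable_under_integral _ _ _ m f D mD t _ _ tI
  (fun x _ => intf x) dv (cst `|C|) G0 iG ub.
have eq := @differentiation_under_integral _ _ _ m f D mD t _ _ tI
  (fun x _ => intf x) dv (cst `|C|) G0 iG ub.
apply: DeriveDef => //; rewrite -derive1E eq.
by apply: eq_Rintegral => u; rewrite inE; exact: d1.
Qed.

End differentiation.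

Section kappa_by_parts.
Local Open Scope classical_set_scope.
Context {R : realType}.
Local Notation mu := (@lebesgue_measure R).
Variable lambda : R.
Hypothesis lambda_gt0 : 0 < lambda.
Local Notation k := (@kappa R lambda).
Local Notation b := (lambda / 2).
Let I01 : set R := `[0, 1].

(** Up to the constant of the density, the integrand times the density is the
    derivative of [(u (1 - u))^b h u], which vanishes at both end points
    because [b > 0]. *)
Lemma kappa_by_parts (h h' : R -> R) :
  (forall x, is_derive x (1 : R) h (h' x)) -> continuous h' ->
  \int[k]_(u in I01) (b * (1 - 2 * u) * h u + u * (1 - u) * h' u) = 0.
Proof.
move=> hh ch'.
have b0 : 0 < b by rewrite divr_gt0.
have ch : continuous h by move=> x; exact: is_derive_continuous (hh x).
have cpol : continuous (fun u : R => u * (1 - u)).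
  move=> x; apply: cvgM; first exact: cvg_id.
  by apply: cvgB; [exact: cvg_cst|exact: cvg_id].
pose phi (u : R) : R := b * (1 - 2 * u) * h u + u * (1 - u) * h' u.
have cphi : continuous phi.
  move=> x; apply: cvgD; apply: cvgM; [|exact: ch|exact: cpol|exact: ch'].
  apply: cvgM; first exact: cvg_cst.
  apply: cvgB; first exact: cvg_cst.
  by apply: cvgM; [exact: cvg_cst|exact: cvg_id].
have mI : measurable (I01 : set (measurableTypeR R)) by exact: measurable_itv.
have mphi : measurable_fun (I01 : set (measurableTypeR R)) phi.
  by apply: measurable_funTS; exact: continuous_measurable_fun.
have [M M0 phiM] := bounded_continuous_segment phi 0 1 cphi.
have bphi : [bounded phi x | x in I01].
  by apply: (bounded_on_le _ _ _ M) => x; rewrite /I01/= in_itv/=; exact: phiM.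
have iphi : k.-integrable I01 (EFin \o phi).
  apply: measurable_bounded_integrable => //.
  by rewrite (le_lt_trans (kappa_le1 lambda lambda_gt0 _ mI))// ltry.
have igp : mu.-integrable I01 ((EFin \o phi) \* (EFin \o kappa_pdf lambda))%E.
  apply: (integrableMr mI mphi bphi).
  exact: integrableS (integrable_kappa_pdf lambda lambda_gt0).
rewrite /Rintegral (integral_kappa lambda lambda_gt0 _ _ mI iphi).
set c := Gamma lambda / Gamma b ^+ 2.
pose G (u : R) : R := c * ((u * (1 - u)) `^ b * h u).
pose g (u : R) : R := c * ((u * (1 - u)) `^ (b - 1)) * phi u.
have gE u : I01 u -> phi u * kappa_pdf lambda u = g u.
  by move=> Iu; rewrite /kappa_pdf patchE mem_set// mulrC.
have -> : (\int[mu]_(x in I01) ((phi x)%:E * (kappa_pdf lambda x)%:E) =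
           \int[mu]_(x in I01) (g x)%:E)%E.
  by apply: eq_integral => x; rewrite inE -EFinM => /gE ->.
have ig : mu.-integrable I01 (EFin \o g).
  apply: eq_integrable igp => // x; rewrite inE => Ix /=.
  by rewrite -EFinM gE.
have pol0 (x : R) : 0 < x < 1 -> 0 < x * (1 - x).
  by move=> /andP[x0 x1]; rewrite mulr_gt0// subr_gt0.
have dpol (x : R) : is_derive x (1 : R) (fun u => u * (1 - u)) (1 - 2 * x).
  apply: (is_derive_conv _ (is_derive_mul (is_derive_id x 1) (is_derive_sub (is_derive_const 1 x) (is_derive_id x 1)))).
  ring.
have dG (x : R) : 0 < x < 1 -> is_derive x (1 : R) G (g x).
  move=> x01; have p0 := pol0 x x01.
  apply: (is_derive_conv _ (is_derive_mul (is_derive_const c x) (is_derive_mul (is_derive_chain (dpol x) (is_derive1_powR b p0)) (hh x)))).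
  rewrite mul0r add0r /g /phi -(mulr_powRB1 (ltW p0) b0); ring.
have G0 : G 0 = 0 by rewrite /G mul0r powR0 ?gt_eqF// mul0r mulr0.
have G1 : G 1 = 0 by rewrite /G subrr mulr0 powR0 ?gt_eqF// mul0r mulr0.
have cG : {within I01, continuous G}.
  apply/(continuous_within_itvP _ ltr01); split.
  + by move=> x; rewrite in_itv/= => /dG; exact: is_derive_continuous.
  + suff : G x @[x --> 0^'+] --> c * (0 * h 0) by rewrite mul0r mulr0 G0.
    apply: cvgM; first exact: cvg_cst.
    apply: cvgM; last by apply: cvg_at_right_filter; exact: ch.
    apply: cvg_powR0 => //.
      near=> x; apply: ltW; apply: pol0; apply/andP; split; near: x.
        exact: nbhs_right_gt.
      exact: nbhs_right_lt.
    have := cpol 0; rewrite /continuous_at mul0r => h0.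
    exact: cvg_at_right_filter.
  + suff : G x @[x --> 1^'-] --> c * (0 * h 1) by rewrite mul0r mulr0 G1.
    apply: cvgM; first exact: cvg_cst.
    apply: cvgM; last by apply: cvg_at_left_filter; exact: ch.
    apply: cvg_powR0 => //.
      near=> x; apply: ltW; apply: pol0; apply/andP; split; near: x.
        exact: nbhs_left_gt.
      exact: nbhs_left_lt.
    have := cpol 1; rewrite /continuous_at subrr mulr0 => h0.
    exact: cvg_at_left_filter.
have cg (x : R) : 0 < x < 1 -> {for x, continuous g}.
  move=> x01; have p0 := pol0 x x01.
  apply: cvgM; last exact: cphi.
  apply: cvgM; first exact: cvg_cst.
  exact: is_derive_continuous (is_derive_chain (dpol x) (is_derive1_powR (b - 1) p0)).
have := Rintegral_derive g G 0 1 ltr01 ig cG dG cg.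
by rewrite G0 G1 subrr.
Unshelve. all: by end_near. Qed.

Lemma kappa_itv01 : k I01 = 1%E.
Proof.
rewrite -(kappa_setT lambda lambda_gt0) /kappa integral_mkcond.
apply: eq_integral => x _; rewrite /kappa_pdf restrict_EFin -patch_setI.
by rewrite setIid.
Qed.

End kappa_by_parts.

(** * Complex moments of kappa *)

Section complex_integral.
Local Open Scope classical_set_scope.
Context {R : realType} {d} {T : measurableType d} (m : {measure set T -> \bar R}).
Variable D : set T.
Hypothesis mD : measurable D.
Hypothesis mDoo : (m D < +oo)%E.
Implicit Types (f g : T -> R[i]) (w : R[i]).

(** The integral over a measurable subset; over the whole space it is
    convertible to [Cintegral].  Restricting to the support of [kappa] is what
    keeps the powers of [u] bounded. *)
Definition Cint f : R[i] :=
  (\int[m]_(x in D) Re (f x)) +i* (\int[m]_(x in D) Im (f x)).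

Definition Cbounded f :=
  [/\ measurable_fun D (fun x => Re (f x)), measurable_fun D (fun x => Im (f x))
    & exists C : R, forall x, D x -> cmod (f x) <= C].

Lemma Cbounded_integrable f : Cbounded f ->
  m.-integrable D (EFin \o (fun x => Re (f x))) /\
  m.-integrable D (EFin \o (fun x => Im (f x))).
Proof.
move=> [mr mi [C fC]]; split; apply: measurable_bounded_integrable => //.
  by apply: (bounded_on_le _ _ _ C) => x /fC; apply: le_trans; exact: norm_Re_le.
by apply: (bounded_on_le _ _ _ C) => x /fC; apply: le_trans; exact: norm_Im_le.
Qed.

Lemma eq_Cint f g : (forall x, D x -> f x = g x) -> Cint f = Cint g.
Proof.
move=> fg; congr Complex.
  by apply: eq_Rintegral => x; rewrite inE => /fg ->.
by apply: eq_Rintegral => x; rewrite inE => /fg ->.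
Qed.

Lemma CboundedD f g : Cbounded f -> Cbounded g -> Cbounded (fun x => f x + g x).
Proof.
move=> [fr fi [C fC]] [gr gi [C' gC]]; split.
- by under eq_fun do rewrite complexpE; exact: measurable_funD.
- by under eq_fun do rewrite complexpE; exact: measurable_funD.
- exists (C + C') => x Dx; apply: le_trans (cmodD_le _ _) _.
  by rewrite lerD ?fC ?gC.
Qed.

Lemma CboundedZ w f : Cbounded f -> Cbounded (fun x => w * f x).
Proof.
move=> [fr fi [C fC]]; split.
- under eq_fun do rewrite complexpE.
  by apply: measurable_funB; exact: measurable_funM.
- under eq_fun do rewrite complexpE.
  by apply: measurable_funD; exact: measurable_funM.
- exists (cmod w * C) => x Dx; rewrite cmodM ler_wpM2l ?fC//.
  by rewrite cmodE sqrtr_ge0.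
Qed.

Lemma CintD f g : Cbounded f -> Cbounded g ->
  Cint (fun x => f x + g x) = Cint f + Cint g.
Proof.
move=> /Cbounded_integrable[fr fi] /Cbounded_integrable[gr gi].
apply: complexP; rewrite complexpE /Cint/=.
  by rewrite -RintegralD//; apply: eq_Rintegral => x _; rewrite complexpE.
by rewrite -RintegralD//; apply: eq_Rintegral => x _; rewrite complexpE.
Qed.

Lemma CintZ w f : Cbounded f -> Cint (fun x => w * f x) = w * Cint f.
Proof.
move=> /Cbounded_integrable[fr fi].
have iZ (r : R) h : m.-integrable D (EFin \o h) ->
    m.-integrable D (EFin \o (fun x => r * h x)).
  by move=> ih; exact: (integrableZl mD r ih).
apply: complexP; rewrite complexpE /Cint/=.
  rewrite -!RintegralZl// -RintegralB//; [|exact: iZ..].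
  by apply: eq_Rintegral => x _; rewrite complexpE.
rewrite -!RintegralZl// -RintegralD//; [|exact: iZ..].
by apply: eq_Rintegral => x _; rewrite complexpE.
Qed.

Lemma is_cderive_Cint (f f' : R -> T -> R[i]) (C : R) (t : R) :
  (forall x u, D u -> is_cderive (f^~ u) x (f' x u)) ->
  (forall x, Cbounded (f x)) ->
  (forall x u, D u -> cmod (f x u) <= C) ->
  (forall x u, D u -> cmod (f' x u) <= C) ->
  is_cderive (fun x => Cint (f x)) t (Cint (f' t)).
Proof.
move=> hf mf fC f'C.
have dRe x u : D u -> is_derive x (1 : R) (fun x => Re (f x u)) (Re (f' x u)).
  by move=> Du; have [] := hf x u Du.
have mRe x : measurable_fun D (fun u => Re (f x u)) by have [] := mf x.
have bRe x u : D u -> `|Re (f x u)| <= C.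
  by move=> Du; rewrite (le_trans (norm_Re_le _))// fC.
have bRe' x u : D u -> `|Re (f' x u)| <= C.
  by move=> Du; rewrite (le_trans (norm_Re_le _))// f'C.
have dIm x u : D u -> is_derive x (1 : R) (fun x => Im (f x u)) (Im (f' x u)).
  by move=> Du; have [] := hf x u Du.
have mIm x : measurable_fun D (fun u => Im (f x u)) by have [] := mf x.
have bIm x u : D u -> `|Im (f x u)| <= C.
  by move=> Du; rewrite (le_trans (norm_Im_le _))// fC.
have bIm' x u : D u -> `|Im (f' x u)| <= C.
  by move=> Du; rewrite (le_trans (norm_Im_le _))// f'C.
split.
  exact: (is_derive_Rintegral m D _ _ C t mD mDoo dRe mRe bRe bRe').
exact: (is_derive_Rintegral m D _ _ C t mD mDoo dIm mIm bIm bIm').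
Qed.

End complex_integral.

Section moments.
Local Open Scope classical_set_scope.
Context {R : realType}.
Variables (z : R[i]) (lambda : R).
Hypothesis z_gt0 : 0 < Im z.
Hypothesis lambda_gt0 : 0 < lambda.
Implicit Types (s t u : R).
Let I01 : set (measurableTypeR R) := `[0, 1].

Let mI : measurable I01. Proof. exact: measurable_itv. Qed.
Let kI : (kappa lambda I01 < +oo)%E.
Proof. by rewrite (le_lt_trans (kappa_le1 lambda lambda_gt0 _ mI))// ltry. Qed.

Lemma Im_zeta (x : R) : Im (z - x%:C) = Im z.
Proof. by rewrite !complexpE/= oppr0 addr0. Qed.

Lemma Im_zeta_gt0 (x : R) : 0 < Im (z - x%:C).
Proof. by rewrite Im_zeta. Qed.

Lemma is_cderive_zeta (c s x : R) :
  is_cderive (fun x => cpowR (z - (c * x)%:C) (- s)) x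
    ((s * c)%:C * cpowR (z - (c * x)%:C) (- (s + 1))).
Proof.
have hz : is_cderive (fun x => z - (c * x)%:C) x (- c%:C).
  apply: is_cderive_eq.
    apply: is_cderiveB; first exact: is_cderive_cst.
    under eq_fun do rewrite rmorphM.
    exact: is_cderiveZ (is_cderive_real x).
  by rewrite mulr1 sub0r.
apply: is_cderive_eq.
  exact: (is_cderive_cpowR (- s) (fun y => Im_zeta_gt0 (c * y)) hz).
by rewrite rmorphN mulrNN -rmorphM opprD.
Qed.

Definition zmom (k : nat) (s t u : R) : R[i] :=
  (u ^+ k)%:C * cpowR (z - (t * u)%:C) (- s).

Definition moment k s t := Cint (kappa lambda) I01 (zmom k s t).

Lemma cmod_zmom k s t u : 0 <= s -> I01 u -> cmod (zmom k s t u) <= Im z `^ (- s).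
Proof.
move=> s0; rewrite /I01/= in_itv/= => /andP[u0 u1].
rewrite /zmom cmodM cmod_real -[leRHS]mul1r ler_pM ?cmodE ?sqrtr_ge0//.
  by rewrite ger0_norm ?exprn_ge0// exprn_ile1.
by rewrite -cmodE -(Im_zeta (t * u)) cmod_cpowRN_le ?Im_zeta.
Qed.

Lemma Cbounded_zmom k s t : 0 <= s ->
  Cbounded I01 (zmom k s t).
Proof.
move=> s0.
have cz (u : R) := is_cderive_zeta t s u.
split; last by exists (Im z `^ (- s)) => u; exact: cmod_zmom.
- rewrite /zmom; under eq_fun do rewrite complexpE /= mul0r subr0.
  apply: measurable_funTS; apply: measurable_funM.
    by apply: measurable_funX; exact: measurable_id.
  by apply: continuous_measurable_fun => u; have [h _] := cz u; exact: is_derive_continuous h.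
- rewrite /zmom; under eq_fun do rewrite complexpE /= mul0r addr0.
  apply: measurable_funTS; apply: measurable_funM.
    by apply: measurable_funX; exact: measurable_id.
  by apply: continuous_measurable_fun => u; have [_ h] := cz u; exact: is_derive_continuous h.
Qed.

(** Differentiation under the integral sign, dominated by a constant. *)
Lemma is_cderive_moment k s t : 0 <= s ->
  is_cderive (moment k s) t (s%:C * moment k.+1 (s + 1) t).
Proof.
move=> s0; have s10 : 0 <= s + 1 by rewrite addr_ge0.
rewrite -CintZ//; last exact: Cbounded_zmom.
pose C := Im z `^ (- s) + s * Im z `^ (- (s + 1)).
apply: (is_cderive_Cint (kappa lambda) I01 mI kI (zmom k s)
  (fun t u => s%:C * zmom k.+1 (s + 1) t u) C).
- move=> x u _; rewrite /zmom.
  apply: is_cderive_eq.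
    apply: is_cderiveZ; under eq_fun do rewrite [_ * u]mulrC.
    exact: is_cderive_zeta.
  by rewrite (mulrC u x) exprSr !rmorphM /=; ring.
- by move=> x; exact: Cbounded_zmom.
- move=> x u Iu; apply: le_trans (cmod_zmom _ _ _ _ s0 Iu) _.
  by rewrite /C lerDl mulr_ge0// powR_ge0.
- move=> x u Iu; rewrite cmodM cmod_real ger0_norm//.
  apply: (@le_trans _ _ (s * Im z `^ (- (s + 1)))).
    by rewrite ler_wpM2l// cmod_zmom.
  by rewrite /C lerDr powR_ge0.
Qed.

Lemma moment_raise k s t : 0 <= s ->
  moment k s t = z * moment k (s + 1) t - t%:C * moment k.+1 (s + 1) t.
Proof.
move=> s0; have s10 : 0 <= s + 1 by rewrite addr_ge0.
have b1 := Cbounded_zmom k (s + 1) t s10.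
have b2 := Cbounded_zmom k.+1 (s + 1) t s10.
rewrite -mulNr -!CintZ// -CintD//; [|exact: CboundedZ..].
apply: eq_Cint => u _; rewrite /zmom.
have -> : - s = - (s + 1) + 1 by ring.
rewrite cpowRD ?Im_zeta_gt0// cpowR1 ?Im_zeta_gt0// exprSr !rmorphM /=; ring.
Qed.

(** [kappa_by_parts] applied to the real and imaginary parts of
    [u |-> (z - t u)^(-s)]. *)
Lemma moment_by_parts s t : 0 <= s ->
  let b := lambda / 2 in
  b%:C * (moment 0 s t - 2 * moment 1 s t) +
  (s * t)%:C * (moment 1 (s + 1) t - moment 2 (s + 1) t) = 0.
Proof.
move=> s0 b; have s10 : 0 <= s + 1 by rewrite addr_ge0.
have b0 := Cbounded_zmom 0 s t s0; have b1 := Cbounded_zmom 1 s t s0.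
have b2 := Cbounded_zmom 1 (s + 1) t s10; have b3 := Cbounded_zmom 2 (s + 1) t s10.
have -> : moment 0 s t - 2 * moment 1 s t =
    Cint (kappa lambda) I01 (fun u => zmom 0 s t u + - 2 * zmom 1 s t u).
  by rewrite CintD ?CintZ ?mulNr//; exact: CboundedZ.
have -> : moment 1 (s + 1) t - moment 2 (s + 1) t =
    Cint (kappa lambda) I01 (fun u => zmom 1 (s + 1) t u + - 1 * zmom 2 (s + 1) t u).
  by rewrite CintD ?CintZ ?mulN1r//; exact: CboundedZ.
have c1 := CboundedD _ _ _ b0 (CboundedZ _ (- 2) _ b1).
have c2 := CboundedD _ _ _ b2 (CboundedZ _ (- 1) _ b3).
rewrite -!CintZ// -CintD//; [|exact: CboundedZ..].
pose h u := cpowR (z - (t * u)%:C) (- s).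
pose h' u := (s * t)%:C * cpowR (z - (t * u)%:C) (- (s + 1)).
have hh (u : R) : is_cderive h u (h' u) := is_cderive_zeta t s u.
have hh' (u : R) : is_cderive h' u _ := is_cderiveZ (s * t)%:C (is_cderive_zeta t (s + 1) u).
have E u : b%:C * (zmom 0 s t u + -2 * zmom 1 s t u) +
    (s * t)%:C * (zmom 1 (s + 1) t u + -1 * zmom 2 (s + 1) t u) =
    (b * (1 - 2 * u))%:C * h u + (u * (1 - u))%:C * h' u.
  rewrite /zmom /h /h' expr0 expr1 expr2 !rmorphM !rmorphB !rmorphM /= !rmorph1.
  rewrite !rmorph_nat; ring.
have dRe (u : R) : is_derive u (1 : R) (fun u => Re (h u)) (Re (h' u)).
  by have [] := hh u.
have dIm (u : R) : is_derive u (1 : R) (fun u => Im (h u)) (Im (h' u)).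
  by have [] := hh u.
have cRe : continuous (fun u => Re (h' u)).
  by move=> u; have [hr _] := hh' u; exact: is_derive_continuous hr.
have cIm : continuous (fun u => Im (h' u)).
  by move=> u; have [_ hi] := hh' u; exact: is_derive_continuous hi.
apply: complexP; rewrite [LHS]/=.
  rewrite [LHS](_ : _ = \int[kappa lambda]_(u in I01)
      (b * (1 - 2 * u) * Re (h u) + u * (1 - u) * Re (h' u))); last first.
    by apply: eq_Rintegral => u _; rewrite E ReD (ReRM _ (h u)) (ReRM _ (h' u)).
  exact: (kappa_by_parts lambda lambda_gt0 _ _ dRe cRe).
rewrite [LHS](_ : _ = \int[kappa lambda]_(u in I01)
    (b * (1 - 2 * u) * Im (h u) + u * (1 - u) * Im (h' u))); last first.
  by apply: eq_Rintegral => u _; rewrite E ImD (ImRM _ (h u)) (ImRM _ (h' u)).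
exact: (kappa_by_parts lambda lambda_gt0 _ _ dIm cIm).
Qed.

Lemma moment_at0 s : moment 0 s 0 = cpowR z (- s).
Proof.
rewrite /moment (@eq_Cint _ _ _ _ _ _ (fun=> cpowR z (- s))); last first.
  by move=> u _; rewrite /zmom expr0 mul1r mul0r subr0.
have kI1 := kappa_itv01 lambda lambda_gt0.
apply: complexP; rewrite /Cint [LHS]/= Rintegral_cst//.
  by rewrite [X in fine X]kI1 mulr1.
by rewrite [X in fine X]kI1 mulr1.
Qed.

End moments.

(** * Square roots, powers of products, and an Euler equation *)

Section powers_and_roots.
Context {R : realType}.
Implicit Types (z w : R[i]) (s t : R).

Lemma Im_half_gt0 z : 0 < Im z -> 0 < Im (clog z / 2) < pi / 2.
Proof.
move=> /Im_clog_gt0 /andP[c0 cpi].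
have -> : clog z / 2 = (2^-1)%:C * clog z by rewrite mulrC fmorphV rmorph_nat.
by rewrite ImRM; apply/andP; split; lra.
Qed.

Lemma Im_sqrtc_gt0 z : 0 < Im z -> 0 < Im (sqrtc z).
Proof.
move=> z0; rewrite sqrtcE//; apply: Im_cexp_gt0.
by have /andP[-> h] := Im_half_gt0 z z0; rewrite (lt_trans h)//; have := pi_gt0 R; lra.
Qed.

Lemma Re_sqrtc_gt0 z : 0 < Im z -> 0 < Re (sqrtc z).
Proof.
move=> z0; rewrite sqrtcE// Re_cexp mulr_gt0 ?expR_gt0//.
have /andP[h0 h] := Im_half_gt0 z z0.
by apply: cos_gt0_pihalf; rewrite h andbT; lra.
Qed.

Lemma sqrtc_cpowR z : 0 < Im z -> sqrtc z = cpowR z 2^-1.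
Proof.
by move=> z0; rewrite sqrtcE// cpowRE// mulrC fmorphV rmorph_nat.
Qed.

Lemma Im_clog_lt_pihalf z : 0 < Re z -> 0 < Im z -> Im (clog z) < pi / 2.
Proof.
move=> x0 y0; rewrite clogE//= gtrBl -(atan0 R).
by apply: lt_atan; rewrite divr_gt0.
Qed.

(** The principal logarithm is additive as long as the arguments do not add up
    beyond [pi]. *)
Lemma clogM z w : 0 < Im z -> 0 < Im w -> Im (clog z) + Im (clog w) < pi ->
  clog (z * w) = clog z + clog w.
Proof.
move=> z0 w0 h; rewrite -{1}(clogK z z0) -{1}(clogK w w0) -cexpD cexpK//.
by rewrite ImD h andbT addr_gt0//; [case/andP: (Im_clog_gt0 z z0)|case/andP: (Im_clog_gt0 w w0)].
Qed.

Lemma cpowRM z w s : 0 < Im z -> 0 < Im w -> Im (clog z) + Im (clog w) < pi ->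
  cpowR (z * w) s = cpowR z s * cpowR w s.
Proof.
move=> z0 w0 h.
have n0 : z * w != 0 by rewrite mulf_neq0 ?Im_gt0_neq0.
by rewrite {1}/cpowR (negbTE n0) clogM// mulrDr cexpD -!cpowRE.
Qed.

Lemma cpowR_sqrtc z s : 0 < Im z -> cpowR (sqrtc z) s = cpowR z (s / 2).
Proof.
move=> z0; rewrite !cpowRE ?Im_sqrtc_gt0// sqrtcE// cexpK.
  by congr cexp; rewrite rmorphM fmorphV rmorph_nat /=; ring.
have /andP[-> h] := Im_half_gt0 z z0; rewrite (lt_trans h)//.
by have := pi_gt0 R; lra.
Qed.

Lemma cpowR_double z s : 0 < Im z ->
  cpowR (z + z) s = (2 `^ s)%:C * cpowR z s.
Proof.
move=> z0; have zz0 : 0 < Im (z + z) by rewrite ImD addr_gt0.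
have e2 : cexp (ln 2 : R)%:C = 2.
  by apply: complexP; rewrite cexpE /= ?cos0 ?sin0 ?mulr1 ?mulr0 ?lnK ?posrE//; ring.
have lE : clog (z + z) = (ln 2)%:C + clog z.
  rewrite -[LHS]cexpK ?Im_clog_gt0// clogK//.
  rewrite -[RHS]cexpK ?ImD ?add0r ?Im_clog_gt0//.
  by rewrite cexpD clogK// e2 mulr_natl mulr2n.
rewrite !cpowRE// lE mulrDr cexpD; congr (_ * _).
by rewrite -rmorphM cexpE /= cos0 sin0 mulr1 mulr0 /powR gt_eqF.
Qed.

Lemma is_cderive_sqrtc z t : 0 < Im z ->
  is_cderive (fun t => sqrtc (z - t%:C)) t (- (2 * sqrtc (z - t%:C))^-1).
Proof.
move=> z0; have zeta0 := Im_zeta_gt0 z z0.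
under eq_fun do rewrite sqrtc_cpowR//.
rewrite sqrtc_cpowR//.
apply: is_cderive_eq.
  apply: is_cderive_cpowR => //.
  exact: is_cderiveB (is_cderive_cst z t) (is_cderive_real t).
have -> : 2^-1 - 1 = - 2^-1 :> R by lra.
rewrite cpowRN// fmorphV rmorph_nat invfM; ring.
Qed.

(** Away from [0] the solutions of [t h' + c h = 0] are multiples of [t^(-c)],
    so only [h = 0] is regular at [0].  To see it without powers of [t]:
    [t |h|^2] has derivative [(1 - 2 c) |h|^2 <= 0] and vanishes at [0], but has
    the sign of [t]; hence it is zero. *)
Lemma euler_ode_eq0 (h dh : R -> R[i]) (c : R) : 1 <= 2 * c ->
  (forall t, is_cderive h t (dh t)) ->
  (forall t, t%:C * dh t + c%:C * h t = 0) -> forall t, h t = 0.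
Proof.
move=> c1 hdh ode.
pose n t := Re (h t) * Re (h t) + Im (h t) * Im (h t).
have n0 t : 0 <= n t by rewrite addr_ge0// -expr2 sqr_ge0.
have odeR t : t * Re (dh t) = - (c * Re (h t)).
  have := congr1 (@Re R) (ode t); rewrite ReD !ReRM /= => /eqP.
  by rewrite addr_eq0 => /eqP.
have odeI t : t * Im (dh t) = - (c * Im (h t)).
  have := congr1 (@Im R) (ode t); rewrite ImD !ImRM /= => /eqP.
  by rewrite addr_eq0 => /eqP.
have dphi t : is_derive t (1 : R) (fun t => t * n t) ((1 - 2 * c) * n t).
  have [dr di] := hdh t.
  apply: (is_derive_conv _ (is_derive_mul (is_derive_id t 1) (is_derive_add (is_derive_mul dr dr) (is_derive_mul di di)))).
  transitivity (n t + 2 * (t * Re (dh t) * Re (h t) + t * Im (dh t) * Im (h t))).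
    by rewrite /n; ring.
  by rewrite odeR odeI /n; ring.
have le (x y : R) : x <= y -> y * n y <= x * n x.
  move=> xy.
  have [c0 _] := MVT_segment xy (fun t _ => dphi t)
    (continuous_subspaceT (fun t => is_derive_continuous _ _ _ (dphi t))).
  move=> e; rewrite -subr_le0 e; apply: mulr_le0_ge0; last by rewrite subr_ge0.
  by apply: mulr_le0_ge0 => //; lra.
have nz t : n t = 0 -> h t = 0.
  move=> /eqP; rewrite /n -!expr2 paddr_eq0 ?sqr_ge0// !sqrf_eq0 => /andP[/eqP r0 /eqP i0].
  by apply: complexP.
move=> t; apply: nz; apply/eqP; rewrite eq_le n0 andbT.
have [t0|t0|->] := ltgtP t 0.
- have := le t 0 (ltW t0); rewrite mul0r => h0.
  by rewrite -(nmulr_rge0 _ t0).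
- have := le 0 t (ltW t0); rewrite mul0r => h0.
  by rewrite -(pmulr_rle0 _ t0).
- have := ode 0; rewrite mul0r add0r => /eqP; rewrite mulf_eq0 => /orP[|/eqP h0].
    by move=> /eqP[c0]; move: c1; rewrite c0; lra.
  by rewrite /n h0 /= mul0r addr0.
Qed.

End powers_and_roots.

(** * The two transforms *)

Section stieltjes.
Context {R : realType}.
Variable z : R[i].
Hypothesis z_gt0 : 0 < Im z.
Let zeta0 t : 0 < Im (z - t%:C) := Im_zeta_gt0 z z_gt0 t.

(** The mean of [(z - t u)^(-2 a)] under the symmetric Beta law with parameter
    [a].  The derivative in [t] of its product with [(z - t)^a] is a multiple of
    the relation [moment_by_parts]. *)
Lemma moment_beta (a t : R) : 0 < a ->
  moment z (2 * a) 0 (2 * a) t = cpowR z (- a) * cpowR (z - t%:C) (- a).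
Proof.
move=> a0; have l0 : 0 < 2 * a by rewrite mulr_gt0.
pose M := moment z (2 * a).
pose P t := M 0 (2 * a) t * cpowR (z - t%:C) a.
have P0 t' : is_cderive P t' 0.
  apply: is_cderive_eq.
    apply: is_cderiveM.
      exact: (is_cderive_moment z (2 * a) z_gt0 l0 0 (2 * a) t' (ltW l0)).
    apply: (is_cderive_cpowR a zeta0).
    exact: is_cderiveB (is_cderive_cst z t') (is_cderive_real t').
  have := moment_by_parts z (2 * a) z_gt0 l0 (2 * a) t' (ltW l0).
  rewrite /= (moment_raise z (2 * a) z_gt0 l0 1) ?(ltW l0)//.
  rewrite /M (moment_raise z (2 * a) z_gt0 l0 0) ?(ltW l0)// -/M.
  have -> : cpowR (z - t'%:C) a = cpowR (z - t'%:C) (a - 1) * (z - t'%:C).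
    exact: cpowR_pred.
  have -> : 2 * a / 2 = a :> R by lra.
  rewrite sub0r !rmorphM rmorph_nat /=.
  move: (cpowR _ _) (M 0 _ _) (M 1 _ _) (M 2 _ _) => q N0 N1 N2 ibp.
  by transitivity (- q * 0); [rewrite -ibp; ring|rewrite mulr0].
have := is_cderive_0_is_cst P P0 t 0.
rewrite /P /M moment_at0// subr0 -cpowRD//.
have -> : - (2 * a) + a = - a by ring.
by move=> <-; rewrite -mulrA -cpowRD// subrr cpowRE// mul0r cexp0 mulr1.
Qed.

Section gegenbauer.
Variable a : R.
Hypothesis a_gt0 : 0 < a.
Let S := sqrtc z.
Let T t := sqrtc (z - t%:C).
Let E t := S + T t.
Let M := moment z (2 * a + 1).

Let l0 : 0 < 2 * a + 1. Proof. by rewrite addr_gt0 ?mulr_gt0. Qed.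
Let T0 t : T t != 0. Proof. exact/Im_gt0_neq0/Im_sqrtc_gt0. Qed.
Let ImE t : 0 < Im (E t). Proof. by rewrite ImD addr_gt0// Im_sqrtc_gt0. Qed.
Let zE : z = S ^+ 2. Proof. by rewrite sqr_sqrtc. Qed.
Let tE t : t%:C = S ^+ 2 - T t ^+ 2.
Proof. by rewrite !sqr_sqrtc opprB addrC subrK. Qed.

Let dE t : is_cderive E t (- (2 * T t)^-1).
Proof.
apply: is_cderive_eq.
  exact: is_cderiveD (is_cderive_cst S t) (is_cderive_sqrtc z t z_gt0).
exact: add0r.
Qed.

Let dM k s t : 0 <= s -> is_cderive (M k s) t (s%:C * M k.+1 (s + 1) t).
Proof. exact: is_cderive_moment. Qed.

Let a1 : 0 <= a + 1. Proof. by rewrite addr_ge0 ?ltW. Qed.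

Let h t := cpowR (E t) (- (2 * a + 1)) * (E t * M 1 (a + 1) t - S * M 0 (a + 1) t).

(** [h] is, up to factors without zeros, the derivative in [t] of
    [M 0 a * E^(2 a)].  The power of [E] in it is the one for which
    [t h' + (2 a + 1) h] becomes a multiple of [moment_by_parts]. *)
Let h0 t : h t = 0.
Proof.
pose dh t : R[i] :=
  (- (2 * a + 1))%:C * (- (2 * T t)^-1) * cpowR (E t) (- (2 * a + 1) - 1) *
    (E t * M 1 (a + 1) t - S * M 0 (a + 1) t) +
  cpowR (E t) (- (2 * a + 1)) *
    (- (2 * T t)^-1 * M 1 (a + 1) t +
     E t * ((a + 1)%:C * M 2 (a + 1 + 1) t) - S * ((a + 1)%:C * M 1 (a + 1 + 1) t)).
have c1 : 1 <= 2 * (2 * a + 1) by have := a_gt0; lra.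
apply: (euler_ode_eq0 h dh (2 * a + 1) c1).
  move=> {}t; apply: is_cderiveM.
    exact: (is_cderive_cpowR _ ImE (dE t)).
  apply: is_cderiveB; last exact: is_cderiveZ (dM _ _ _ a1).
  exact: is_cderiveM (dE t) (dM _ _ _ a1).
move=> {}t; have := moment_by_parts z (2 * a + 1) z_gt0 l0 (a + 1) t a1.
rewrite /h /dh /M (moment_raise z (2 * a + 1) z_gt0 l0 0 _ t a1).
rewrite (moment_raise z (2 * a + 1) z_gt0 l0 1 _ t a1) -/M.
have -> : cpowR (E t) (- (2 * a + 1)) = cpowR (E t) (- (2 * a + 1) - 1) * E t.
  exact: cpowR_pred.
rewrite !rmorphM rmorphN !rmorphD !rmorphM rmorph1 fmorphV rmorph_nat /= (tE t) zE /E.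
move: (cpowR _ _) (M 0 _ _) (M 1 _ _) (M 2 _ _) => q N0 N1 N2.
have := T0 t; move: (T t) => Tt Tt0 ibp.
(* With [t = S^2 - T^2] and [E = S + T] the multiplier of the by-parts
   relation is read off from the coefficient of [M 0 (a + 2)]. *)
transitivity (- q * S * (S + Tt) ^+ 2 / Tt * 0); last by rewrite mulr0.
by rewrite -ibp; field; rewrite Tt0.
Qed.

(** The generating function of the Gegenbauer polynomials has mean [1] under
    their weight.  The derivative in [t] of the left-hand side is a multiple
    of [h], and at [t = 0] one has [E 0 = 2 sqrt z]. *)
Lemma moment_gegenbauer t :
  M 0 a t * cpowR (E t) (2 * a) = (2 `^ (2 * a))%:C.
Proof.
pose f t := M 0 a t * cpowR (E t) (2 * a).
have f0 t' : is_cderive f t' 0.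
  apply: is_cderive_eq.
    apply: is_cderiveM; first exact: dM (ltW a_gt0).
    exact: (is_cderive_cpowR _ ImE (dE t')).
  have /eqP := h0 t'; rewrite mulf_eq0 (negbTE (cpowR_neq0 _ _ (ImE t')))/= => /eqP.
  have -> : cpowR (E t') (2 * a) = cpowR (E t') (2 * a - 1) * E t'.
    exact: cpowR_pred.
  rewrite /M (moment_raise z (2 * a + 1) z_gt0 l0 0 _ t' (ltW a_gt0)) -/M.
  rewrite !rmorphM rmorph_nat /= (tE t') zE /E.
  move: (cpowR _ _) (M 0 _ _) (M 1 _ _) => q B A.
  have := T0 t'; move: (T t') => Tt Tt0 AB.
  transitivity (q * a%:C * S / Tt * 0); last by rewrite mulr0.
  by rewrite -AB; field; rewrite Tt0.
rewrite [LHS](is_cderive_0_is_cst f f0 t 0) /f /M moment_at0//.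
have -> : E 0 = S + S by rewrite /E /T subr0.
rewrite cpowR_double ?Im_sqrtc_gt0// cpowR_sqrtc//.
have -> : 2 * a / 2 = a :> R by lra.
by rewrite mulrCA -cpowRD// addNr cpowRE// mul0r cexp0 mulr1.
Qed.

End gegenbauer.
End stieltjes.

(** * The law of the product *)

Section mulconv_integral.
Local Open Scope classical_set_scope.
Context {R : realType}.
Variables P Q : {sigma_finite_measure set (measurableTypeR R) -> \bar R}.
Hypotheses (Poo : (P setT < +oo)%E) (Qoo : (Q setT < +oo)%E).

(** Transfer of the integral to the product measure, then Fubini, the factor of
    law [P] being integrated first. *)
Lemma Rintegral_mulconv (f : R -> R) (C : R) :
  measurable_fun [set: measurableTypeR R] f -> (forall x, `|f x| <= C) ->
  \int[mulconv P Q]_x f x = \int[Q]_v \int[P]_u f (u * v).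
Proof.
move=> mf fC.
pose g (uv : measurableTypeR R * measurableTypeR R) : R := f (uv.1 * uv.2).
have mg : measurable_fun setT g by exact: measurableT_comp mf measurable_mulR2.
have bdd (T : Type) (h : T -> R) : (forall x, `|h x| <= C) ->
    [bounded h x | x in [set: T]].
  by move=> hC; exact: (bounded_on_le _ _ _ C (fun x _ => hC x)).
have PQoo : ((P \x Q)%E setT < +oo)%E.
  rewrite -setXTT product_measure1E// lte_mul_pinfty//.
  by rewrite ge0_fin_numE.
have ig : (P \x Q)%E.-integrable setT (EFin \o g).
  by apply: measurable_bounded_integrable => //; apply: bdd => x; exact: fC.
rewrite /Rintegral.
rewrite (_ : \int[mulconv P Q]_x (f x)%:E =
    \int[pushforward (P \x Q)%E mulR2]_x (f x)%:E)%E //.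
rewrite (integral_pushforward measurable_mulR2 _ (f := EFin \o f)) //=; last first.
  exact/measurable_EFinP.
rewrite preimage_setT -integral21_prod_meas1//.
congr fine; apply: eq_integral => v _.
rewrite fineK//; apply: integrable_fin_num => //.
apply: measurable_bounded_integrable => //.
  apply: measurableT_comp mf _; exact: measurable_funM.
by apply: bdd => u; exact: fC.
Qed.

Lemma Cintegral_mulconv (f : R -> R[i]) : Cbounded [set: measurableTypeR R] f ->
  Cintegral (mulconv P Q) f =
  Cintegral Q (fun v => Cintegral P (fun u => f (u * v))).
Proof.
move=> [mr mi [C fC]]; congr Complex.
  apply: (Rintegral_mulconv (fun x => Re (f x)) C) => // x.
  by apply: le_trans (fC x I); exact: norm_Re_le.
apply: (Rintegral_mulconv (fun x => Im (f x)) C) => // x.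
by apply: le_trans (fC x I); exact: norm_Im_le.
Qed.

End mulconv_integral.

Section kappa_support.
Local Open Scope classical_set_scope.
Context {R : realType}.

Lemma Cintegral_kappa (lambda : R) (f : R -> R[i]) : 0 < lambda ->
  Cbounded [set: measurableTypeR R] f ->
  Cintegral (kappa lambda) f = Cint (kappa lambda) `[0, 1] f.
Proof.
move=> l0 bf.
have mI : measurable (`[0, 1] : set (measurableTypeR R)) by exact: measurable_itv.
have koo : (kappa lambda [set: measurableTypeR R] < +oo)%E.
  by rewrite kappa_setT// ltry.
have k0 : kappa lambda (~` `[0, 1] : set (measurableTypeR R)) = 0%E.
  rewrite -setTD measureD// setTI.
  by rewrite [X in (X - _)%E]kappa_setT// [X in (_ - X)%E]kappa_itv01// subee.
have [ir ii] := Cbounded_integrable _ _ measurableT koo f bf.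
have sp g : (kappa lambda).-integrable [set: measurableTypeR R] (EFin \o g) ->
    \int[kappa lambda]_x g x = \int[kappa lambda]_(x in `[0, 1]) g x.
  move=> ig; rewrite /Rintegral.
  rewrite (negligible_integral (measurableC mI) measurableT ig k0).
  by rewrite setTD setCK.
by congr Complex; apply: sp.
Qed.

End kappa_support.

Theorem proposition4p3 (R : realType) (lambda : R) (z : R[i])
    (lambda_gt0 : 0 < lambda) (Imz_gt0 : 0 < complex.Im z) :
  Cintegral (mulconv (kappa lambda) (kappa (lambda + 1)))
    (fun x => 1 / cpowR (z - x%:C) lambda)
  = (2 `^ lambda)%:C / cpowR (z + sqrtc z * sqrtc (z - 1)) lambda.
Proof.
have [a a0 lE] : exists2 a : R, 0 < a & lambda = 2 * a.
  by exists (lambda / 2); [rewrite divr_gt0|rewrite mulrC divfK].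
subst lambda.
have l10 : 0 < 2 * a + 1 by rewrite addr_gt0.
have zeta0 (x : R) : 0 < Im (z - x%:C) := Im_zeta_gt0 z Imz_gt0 x.
have bz (c s : R) : 0 <= s ->
    Cbounded [set: measurableTypeR R] (fun u => cpowR (z - (c * u)%:C) (- s)).
  move=> s0; have dz (u : R) := is_cderive_zeta z Imz_gt0 c s u.
  split.
  - by apply: continuous_measurable_fun => u; have [h _] := dz u; exact: is_derive_continuous h.
  - by apply: continuous_measurable_fun => u; have [_ h] := dz u; exact: is_derive_continuous h.
  - exists (Im z `^ (- s)) => u _; rewrite -(Im_zeta z (c * u)).
    by rewrite cmod_cpowRN_le.
have b1 (s : R) : 0 <= s ->
    Cbounded [set: measurableTypeR R] (fun u => cpowR (z - u%:C) (- s)).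
  by move=> s0; have := bz 1 s s0; under eq_fun do rewrite mul1r.
have -> : (fun x : R => 1 / cpowR (z - x%:C) (2 * a)) =
          (fun x => cpowR (z - x%:C) (- (2 * a))).
  by apply/funext => x; rewrite cpowRN// mul1r.
rewrite Cintegral_mulconv; last 3 first.
- by rewrite [ltLHS]kappa_setT// ltry.
- by rewrite [ltLHS]kappa_setT// ltry.
- exact: b1 (ltW lambda_gt0).
have -> : (fun v => Cintegral (kappa (2 * a)) (fun u => cpowR (z - (u * v)%:C) (- (2 * a)))) =
          (fun v => cpowR z (- a) * cpowR (z - v%:C) (- a)).
  apply/funext => v; under [X in Cintegral _ X]eq_fun do rewrite mulrC.
  rewrite Cintegral_kappa//; last exact: bz (ltW lambda_gt0).
  rewrite -(moment_beta z Imz_gt0 a v a0); apply: eq_Cint => u _.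
  by rewrite /zmom expr0 mul1r.
have ba := b1 a (ltW a0).
rewrite Cintegral_kappa//; last exact: CboundedZ ba.
have mI : measurable (`[0, 1] : set (measurableTypeR R)) by exact: measurable_itv.
have kI : (kappa (2 * a + 1)%R `[0%R, 1%R] < +oo)%E.
  by rewrite [ltLHS]kappa_itv01// ltry.
rewrite CintZ//; last first.
  have [mr mi [C fC]] := ba.
  by split; [exact: measurable_funTS|exact: measurable_funTS|exists C => u _; exact: fC].
have -> : Cint (kappa (2 * a + 1)) `[0, 1] (fun u => cpowR (z - u%:C) (- a)) =
          moment z (2 * a + 1) 0 a 1.
  by apply: eq_Cint => u _; rewrite /zmom expr0 !mul1r.
have := moment_gegenbauer z Imz_gt0 a a0 1.
set S := sqrtc z; set T := sqrtc (z - 1%:C).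
have T0 : 0 < Im T by exact: Im_sqrtc_gt0.
have S0 : 0 < Im S by exact: Im_sqrtc_gt0.
have E0 : 0 < Im (S + T) by rewrite ImD addr_gt0.
have rE0 : 0 < Re (S + T) by rewrite ReD addr_gt0// Re_sqrtc_gt0.
have -> : z + S * T = S * (S + T) by rewrite mulrDr -expr2 sqr_sqrtc.
rewrite cpowRM//; last first.
  have := Im_clog_lt_pihalf S (Re_sqrtc_gt0 z Imz_gt0) S0.
  by have := Im_clog_lt_pihalf (S + T) rE0 E0; lra.
rewrite cpowR_sqrtc//.
have -> : 2 * a / 2 = a :> R by lra.
move=> <-.
have n1 := cpowR_neq0 z a Imz_gt0; have n2 := cpowR_neq0 (S + T) (2 * a) E0.
by rewrite cpowRN//; field; rewrite n1 n2.
Qed.
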